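(* Let $V$ be a real finite dimensional vector space, $C\subset V$ an open nondegenerate convex cone and $L\subset V$ a lattice. Then the convex hull $[C\cap L]$ of $C\cap L$ is locally rationally polyhedral in $V$, relative to the $\mathbb{Q}$-structure on $V$ defined by $L$. In particular, $[C\cap L]$ is closed in $V$.
   Context: A cone in $V$ is a nonempty subset invariant under multiplication by positive scalars (it need not contain the origin). A convex set is nondegenerate if it does not contain an affine line. A lattice in $V$ is the $\mathbb{Z}$-span of an $\mathbb{R}$-basis of $V$; the $\mathbb{Q}$-structure it defines is $V(\mathbb{Q})=\mathbb{Q}L$. $[Z]$ denotes the convex hull of $Z$. A polyhedron in a real finite dimensional affine space is a subset that can be defined by finitely many affine-linear nonstrict inequalities (of the form $f\le 0$); if the affine space has a $\mathbb{Q}$-structure and the affine-linear forms can be taken to be defined over $\mathbb{Q}$, the polyhedron is called rational. A subset is locally rationally polyhedral if its intersection with every bounded rational polyhedron is a rational polyhedron. *)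

(* Defs.v *)
From HB Require Import structures.
From mathcomp Require Import all_boot all_order all_algebra.
From mathcomp Require Import all_classical all_reals all_analysis.

Set Implicit Arguments.
Unset Strict Implicit.
Unset Printing Implicit Defensive.

Import Order.TTheory GRing.Theory Num.Theory.
Import numFieldNormedType.Exports.

Local Open Scope classical_set_scope.
Local Open Scope ring_scope.

Section Defs.
Context {R : realType} {V : vectType R}.
Implicit Types (C L P Q Z : set V) (f : V -> R).

(* The standard topology of V is transported from 'rV[R]_n along the           *)
(* coordinates in a basis; it does not depend on the basis, and neither does   *)
(* the resulting notion of boundedness.                                        *)
Definition coords : V -> 'rV[R]_(\dim {:V}) := passmx.rVof (vbasis {:V}).

Definition vopen Z := open (Z : set (initial_topology coords)).

Definition vclosed Z := closed (Z : set (initial_topology coords)).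

Definition vbounded Z := bounded_set (coords @` Z).

Definition convex_hull Z : set V := smallest (@convex_set R V) Z.

Definition is_cone C :=
  C !=set0 /\ forall (t : R) (v : V), 0 < t -> C v -> C (t *: v).

Definition nondegenerate_set Z :=
  ~ exists p v : V, v != 0 /\ forall t : R, Z (p + t *: v).

Definition is_lattice L :=
  exists2 b : (\dim {:V}).-tuple V, basis_of {:V} b & L = [set v | inIntSpan b v].

Definition rat_span L : set V :=
  [set v | exists (n : nat) (q : 'I_n -> rat) (l : 'I_n -> V),
     (forall i, L (l i)) /\ v = \sum_(i < n) ratr (q i) *: l i].

Definition affine_form f :=
  exists (phi : {scalar V}) (c : R), forall v, f v = phi v + c.

(* Q stands for the set V(Q) of rational points of a rational structure on V;  *)
(* an affine-linear form is defined over the rationals when its values on      *)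
(* V(Q) are rational.                                                          *)
Definition rational_form Q f := affine_form f /\ f @` Q `<=` rational.

Definition rational_polyhedron Q P :=
  exists (m : nat) (f : 'I_m -> V -> R),
    (forall i, rational_form Q (f i)) /\ P = [set v | forall i, f i v <= 0].

Definition locally_rationally_polyhedral Q Z :=
  forall P, rational_polyhedron Q P -> vbounded P ->
    rational_polyhedron Q (Z `&` P).

End Defs.

(* Main.v *)
From HB Require Import structures.
Require Import Defs.
From mathcomp Require Import all_boot all_order all_algebra.
From mathcomp Require Import all_classical all_reals all_analysis.
From mathcomp Require Import lra ring.
Set Implicit Arguments.
Unset Strict Implicit.
Unset Printing Implicit Defensive.
Import Order.TTheory GRing.Theory Num.Theory.
Import numFieldNormedType.Exports passmx.
Local Open Scope classical_set_scope.
Local Open Scope ring_scope.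


(** Write [E] for R^n with the sup norm, the lattice being the set of integral
vectors, and let [K] be the hull of the integral vectors of the cone [C].  The
point is that for every bound [M] there is a bound [N] such that every [x] in
[K] with [|x| <= M] is a convex combination of the finitely many integral
vectors of [C] of norm at most [N] (lemma [hull_bounded]).  Then [K] agrees, on
a bounded set, with the hull of a finite set of rational points, which is a
rational polyhedron by Fourier-Motzkin elimination ([comb_points_forms]); local
polyhedrality and closedness both follow.

The heart of the matter is a statement on an arbitrary open convex set [A]
containing the origin: the convex cone spanned by the integral vectors of [A] is
finitely generated ([int_cone_generated]).  By compactness of the unit sphere
this is a question about directions.  No point of [A] lies far away near a
direction [w] that leaves [A].  If on the contrary the whole ray through [w]
lies in [A], so does a tube around it, and Dirichlet's theorem puts integral
vectors in an arbitrarily thin tube.  Those close enough to the ray span a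
rational subspace [W1] containing [w], however thin the tube.  Finitely many of
them generate a cone which is a neighbourhood of [w] inside [W1] ([cone_nbhd]),
and modulo [W1] one argues by induction on the codimension, for the set
[A + W1]: the generators obtained there lift to integral vectors of [A]
([lift_mod]) because rounding errors can be absorbed in the tube.  To run
this induction without passing to quotient lattices, everything is stated modulo
the row space of an integral matrix [W] under which [A] is invariant.  The
statement also bounds the coefficients used by the norm of the vector modulo
[W]; this is what keeps the component in [W1] of a vector close to the direction
[w] inside the neighbourhood just mentioned.

Applied to [C - v] for an integral vector [v] of [C], this shows that [K] is
contained in [v] plus the cone generated by [S - v] for some finite set [S] of
integral vectors of [C] ([local_cone]).  Since [C] contains no line, a convex
combination of points of [C] that is bounded must involve a generator that is
bounded ([small_generator]), so only finitely many [v] matter and one [S] serves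
them all.  If a point [x] of [K] were outside the hull of [S], consider the last
point [y] of that hull on a segment from a small generator of [x] to [x]: some
small [v] occurs in [y] with positive weight, and a little of that weight can be
traded for a move along [x - v], so the hull contains points of the segment
beyond [y], which is absurd. *)
(** * Norms and integral matrices *)

Section Norm.
Context {R : realType}.

Lemma entry_le_norm m n (M : 'M[R]_(m, n)) i j : `|M i j| <= `|M|.
Proof.
rewrite [leRHS]/Num.Def.normr /= mx_normrE; apply/bigmax_geP; right.
by exists (i, j).
Qed.

Lemma norm_le m n (M : 'M[R]_(m, n)) c :
  0 <= c -> (forall i j, `|M i j| <= c) -> `|M| <= c.
Proof.
move=> c0 Mc; rewrite [leLHS]/Num.Def.normr /= mx_normrE.
by apply/bigmax_leP; split=> // -[i j].
Qed.

Lemma row_le_norm m n (M : 'M[R]_(m, n)) i : `|row i M| <= `|M|.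
Proof. by apply: norm_le => // a j; rewrite mxE entry_le_norm. Qed.

Lemma mulmx_le_norm m n p (M : 'M[R]_(m, n)) (N : 'M[R]_(n, p)) :
  `|M *m N| <= n%:R * (`|M| * `|N|).
Proof.
apply: norm_le => [|i j]; first by rewrite !mulr_ge0.
rewrite mxE (le_trans (ler_norm_sum _ _ _))//.
have -> : n%:R * (`|M| * `|N|) = \sum_(k < n) `|M| * `|N|.
  by rewrite sumr_const card_ord mulr_natl.
by apply: ler_sum => k _; rewrite normrM ler_pM ?entry_le_norm.
Qed.

Lemma mulmx_bounded n p (N : 'M[R]_(n, p)) :
  exists2 c : R, 0 < c & forall m (M : 'M[R]_(m, n)), `|M *m N| <= c * `|M|.
Proof.
exists (n%:R * `|N| + 1) => [|m M]; first by rewrite ltr_wpDl ?mulr_ge0.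
apply: le_trans (mulmx_le_norm _ _) _.
have := normr_ge0 M; nra.
Qed.

Lemma unit_sphere_compact n : compact [set x : 'rV[R]_n | `|x| = 1].
Proof.
apply: bounded_closed_compact.
  by exists 1; split=> // y y1 x /= ->; exact: ltW.
rewrite (_ : mkset _ = Num.Def.normr @^-1` [set 1]); last by [].
apply: closed_comp; last exact: closed_eq.
by move=> x _; exact: norm_continuous.
Qed.

Lemma near_norm n (x : 'rV[R]_n) (e : R) : 0 < e ->
  \forall y \near x, `|y - x| < e.
Proof.
move=> e0; apply: filterS (nbhsx_ballx x e e0) => y.
by rewrite mx_norm_ball /ball_ /= distrC.
Qed.

End Norm.

Section Int.
Context {R : realType}.

Definition intmx m n (M : 'M[R]_(m, n)) := M \is a mxOver Num.int.

Lemma intmx0 m n : intmx (0 : 'M[R]_(m, n)).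
Proof. exact: mxOver0. Qed.

Lemma intmxD m n (M N : 'M[R]_(m, n)) : intmx M -> intmx N -> intmx (M + N).
Proof.
move=> /mxOverP Mi /mxOverP Ni; apply/mxOverP => i j.
by rewrite !mxE rpredD.
Qed.

Lemma intmxB m n (M N : 'M[R]_(m, n)) : intmx M -> intmx N -> intmx (M - N).
Proof.
move=> /mxOverP Mi /mxOverP Ni; apply/mxOverP => i j.
by rewrite !mxE rpredB.
Qed.

Lemma intmxM m n p (M : 'M[R]_(m, n)) (N : 'M[R]_(n, p)) :
  intmx M -> intmx N -> intmx (M *m N).
Proof. exact: mxOverM. Qed.

Definition floormx m n (M : 'M[R]_(m, n)) : 'M[R]_(m, n) :=
  map_mx (fun a => (Num.floor a)%:~R) M.

Lemma floormx_int m n (M : 'M[R]_(m, n)) : intmx (floormx M).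
Proof. by apply/mxOverP => i j; rewrite mxE intr_int. Qed.

Lemma fracmx_ge0 m n (M : 'M[R]_(m, n)) i j : 0 <= (M - floormx M) i j.
Proof. by rewrite !mxE subr_ge0 floor_le. Qed.

Lemma fracmx_lt1 m n (M : 'M[R]_(m, n)) i j : (M - floormx M) i j < 1.
Proof. by rewrite !mxE ltrBlDl -[X in _ + X]/(1%:~R) -intrD floorD1_gt. Qed.

Lemma fracmx_norm m n (M : 'M[R]_(m, n)) : `|M - floormx M| <= 1.
Proof.
apply: norm_le => // i j.
by rewrite ger0_norm ?fracmx_ge0// ltW ?fracmx_lt1.
Qed.

Lemma finite_int_ball n (r : R) :
  finite_set [set x : 'rV[R]_n | intmx x /\ `|x| <= r].
Proof.
pose N := Num.bound r.
pose f (g : {ffun 'I_n -> 'I_(N + N).+1}) : 'rV[R]_n :=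
  \row_j ((g j)%:R - N%:R).
apply: (@sub_finite_set _ _ (f @` setT)); last exact: finite_image.
move=> x [/mxOverP xi xr] /=.
have xN j : `|x 0 j| <= N%:R.
  rewrite (le_trans (entry_le_norm _ _ _))// (le_trans xr)// ltW//.
  by rewrite archi_boundP// (le_trans _ xr).
exists [ffun j => inord (Num.trunc (x 0 j + N%:R))] => //.
apply/rowP => j; rewrite !mxE ffunE.
have /natrP[k kE] : x 0 j + N%:R \is a Num.nat.
  rewrite natrEint; apply/andP; split; first by rewrite rpredD ?xi ?natr_int.
  by have := xN j; rewrite ler_norml => /andP[? _]; rewrite -lerBlDr sub0r.
rewrite kE natrK inordK ?ltnS; last first.
  rewrite -(ler_nat R) -kE natrD lerD2r.
  by have := xN j; rewrite ler_norml => /andP[].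
by rewrite -kE addrK.
Qed.

Lemma finite_uniform (T : choiceType) (A : set T) (P : T -> R -> Prop) :
  finite_set A -> (forall x N N', N <= N' -> P x N -> P x N') ->
  (forall x, A x -> exists N, P x N) ->
  exists N, forall x, A x -> P x N.
Proof.
move=> /finite_seqP[s ->] mon ex.
suff: forall t : seq T, {subset t <= s} -> exists N, forall x, x \in t -> P x N.
  by move=> /(_ s); apply.
elim=> [|x t IH] ts; first by exists 0.
have [N tN] := IH (fun y yt => ts y (@mem_behead _ (x :: t) y yt)).
have [N' xN] := ex x (ts x (mem_head _ _)).
exists (Num.max N N') => y; rewrite inE => /predU1P[->|/tN yN].
  by apply: mon xN; rewrite le_max lexx orbT.
by apply: mon yN; rewrite le_max lexx.
Qed.

End Int.

(** * Weighted combinations *)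

Section Comb.
Context {R : realType} {V : lmodType R}.
Implicit Types (S T : set V) (c s t : R) (x y f v : V).

(** [comb S c x] records the exact total weight [c], so that the same notion
    covers conical combinations ([c] arbitrary) and convex ones ([c = 1]). *)
Inductive comb S : R -> V -> Prop :=
| comb_nil : comb S 0 0
| comb_cons s f c x : 0 <= s -> S f -> comb S c x ->
    comb S (s + c) (s *: f + x).

Lemma comb_ge0 S c x : comb S c x -> 0 <= c.
Proof. by elim=> // s f c' x' s0 _ _ c0; rewrite addr_ge0. Qed.

Lemma comb_atom S s f : 0 <= s -> S f -> comb S s (s *: f).
Proof.
by move=> s0 Sf; have := comb_cons s0 Sf (comb_nil S); rewrite !addr0.
Qed.

Lemma comb_add S c x c' x' :
  comb S c x -> comb S c' x' -> comb S (c + c') (x + x').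
Proof.
move=> cx cx'; elim: cx => [|s f d y s0 Sf _ IH]; first by rewrite !add0r.
by rewrite -!addrA; exact: comb_cons.
Qed.

Lemma comb_scale S a c x : 0 <= a -> comb S c x -> comb S (a * c) (a *: x).
Proof.
move=> a0; elim=> [|s f d y s0 Sf _ IH].
  by rewrite mulr0 scaler0; exact: comb_nil.
by rewrite mulrDr scalerDr scalerA; apply: comb_cons; rewrite ?mulr_ge0.
Qed.

Lemma comb_sub S T c x : S `<=` T -> comb S c x -> comb T c x.
Proof.
move=> ST; elim=> [|s f d y s0 Sf _ IH]; first exact: comb_nil.
by apply: comb_cons => //; exact: ST.
Qed.

Lemma comb_sum S n (c : 'I_n -> R) (x : 'I_n -> V) :
  (forall i, comb S (c i) (x i)) -> comb S (\sum_i c i) (\sum_i x i).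
Proof.
move=> cx; elim/big_ind2: _ => [|? ? ? ? ? ?|//]; first exact: comb_nil.
exact: comb_add.
Qed.

Lemma comb_shift S v c x :
  comb [set f | S (f + v)] c x -> comb S c (x + c *: v).
Proof.
elim=> [|s f d y s0 Sf _ IH]; first by rewrite scale0r addr0; exact: comb_nil.
rewrite scalerDl addrACA -scalerDr; exact: comb_cons.
Qed.

Lemma comb_bind S T v c x : (forall f, S f -> exists d, comb T d (f - v)) ->
  comb S c x -> exists d, comb T d (x - c *: v).
Proof.
move=> ST; elim=> [|s f d y s0 Sf _ [e IH]].
  by exists 0; rewrite scale0r subr0; exact: comb_nil.
have [e' fe'] := ST f Sf; exists (s * e' + e).
by rewrite scalerDl opprD addrACA -scalerBr; apply/comb_add/IH/comb_scale.
Qed.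

End Comb.

(** Convex combinations form a convex set; conversely a convex set containing
    the generators contains every combination of positive weight [c] once it is
    divided by [c], by induction on its length. *)
Lemma comb_hull (R : realType) (V : vectType R) (S : set V) :
  convex_hull S = comb S 1.
Proof.
rewrite eqEsubset; split.
  apply: smallest_sub => [x y l|f Sf].
    rewrite !inE => cx cy; rewrite /conv /=.
    rewrite (_ : 1 = l%:num * 1 + (1 - l%:num) * 1); last by ring.
    by apply: comb_add; apply: comb_scale.
  by rewrite -[f]scale1r; exact: comb_atom.
move=> x cx D [Dc SD].
suff: forall c y, comb S c y -> (c = 0 /\ y = 0) \/ (0 < c /\ D (c^-1 *: y)).
  by move=> /(_ _ _ cx)[[/eqP]|[_]]; rewrite ?oner_eq0// invr1 scale1r.
move=> c y; elim=> [|s f d z s0 /SD Df dz IH]; first by left.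
have := s0; rewrite le_eqVlt => /predU1P[<-|s_gt0].
  by rewrite add0r scale0r add0r.
right; case: IH => [[-> ->]|[d0 Dz]].
  by rewrite !addr0 scalerA mulVf ?gt_eqF// scale1r.
have sd0 : 0 < s + d by rewrite addr_gt0.
split=> //.
have l0 : 0 <= s / (s + d) by rewrite divr_ge0// ltW.
have l1 : s / (s + d) <= 1 by rewrite ler_pdivrMr// mul1r lerDl ltW.
have := Dc f (d^-1 *: z) (Itv01 l0 l1) (mem_set Df) (mem_set Dz).
rewrite inE /conv /=; congr D.
rewrite scalerDr !scalerA.
by congr (_ *: _ + _ *: _); rewrite /= ?/unstable.onem; field; lra.
Qed.

Lemma comb_norm (R : realType) (n : nat) (S : set 'rV[R]_n) N c x :
  (forall f, S f -> `|f| <= N) -> comb S c x -> `|x| <= c * N.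
Proof.
move=> SN; elim=> [|s f d y s0 /SN fN _ IH]; first by rewrite normr0 mul0r.
rewrite mulrDl (le_trans (ler_normD _ _))// lerD// normrZ ger0_norm//.
by rewrite ler_wpM2l.
Qed.

Lemma comb_transfer (R : realType) m n (W : 'M[R]_(m, n))
    (S T : set 'rV[R]_n) c x :
  (forall f, S f -> exists2 f', T f' & (f - f' <= W)%MS) ->
  comb S c x -> exists2 x', comb T c x' & (x - x' <= W)%MS.
Proof.
move=> ST; elim=> [|s f d y s0 /ST[f' Tf' ff'] _ [y' dy' yy']].
  by exists 0; rewrite ?subr0 ?sub0mx//; exact: comb_nil.
exists (s *: f' + y'); first exact: comb_cons.
by rewrite opprD addrACA -scalerBr addmx_sub ?scalemx_sub.
Qed.

(** * Dirichlet approximation *)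

Section Dirichlet.
Context {R : realType} {n : nat}.
Implicit Types (w l : 'rV[R]_n).

(** Pigeonhole principle: two of the points [j * T * w] fall into the same small
    box modulo the lattice, and their difference is [t * w] up to [e]. *)
Lemma dirichlet w (e T : R) : 0 < e ->
  exists l t, [/\ intmx l, T <= t & `|l - t *: w| < e].
Proof.
move=> e0; wlog T0 : T / 0 < T => [H|].
  have [|l [t [li tT lt]]] := H (Num.max T 1).
    by rewrite lt_max ltr01 orbT.
  by exists l, t; split=> //; apply: le_trans tT; rewrite le_max lexx.
pose k := Num.bound e^-1; pose K : R := k.+1%:R.
have K0 : 0 < K by rewrite ltr0n.
have Ke : K^-1 < e.
  rewrite invf_plt ?posrE// (lt_trans (archi_boundP _)) ?invr_ge0 1?ltW//.
  by rewrite ltr_nat.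
pose p (j : nat) : 'rV[R]_n := (j%:R * T) *: w.
pose fr j := p j - floormx (p j).
have fr0 j i : 0 <= fr j 0 i by exact: fracmx_ge0.
have fr1 j i : fr j 0 i < 1 by exact: fracmx_lt1.
pose box (j : 'I_(k.+1 ^ n).+1) : {ffun 'I_n -> 'I_k.+1} :=
  [ffun i => inord (Num.trunc (K * fr j 0 i))].
have /injectivePn[i [j ij bij]] : ~~ injectiveb box.
  apply/negP => /injectiveP/leq_card.
  by rewrite card_ffun !card_ord ltnn.
wlog lij : i j ij bij / (i < j)%N => [H|].
  have [lij|lji|eij] := ltngtP i j; first exact: (H i j).
    by apply: (H j i) => //; rewrite eq_sym.
  by move: ij; rewrite (ord_inj eij) eqxx.
exists (floormx (p j) - floormx (p i)), ((j - i)%:R * T); split.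
- by apply: intmxB; exact: floormx_int.
- by rewrite ler_peMl ?ler1n ?subn_gt0// ltW.
have -> : floormx (p j) - floormx (p i) - ((j - i)%:R * T) *: w = fr i - fr j.
  have -> : ((j - i)%:R * T) *: w = p j - p i.
    by rewrite /p natrB 1?ltnW// mulrBl scalerBl.
  by apply/rowP => b; rewrite !mxE; ring.
apply: le_lt_trans Ke; apply: norm_le => [|a b]; first by rewrite invr_ge0 ltW.
rewrite ord1 [_ 0 b]mxE [X in _ + X]mxE.
have := congr1 (fun f : {ffun _ -> _} => val (f b)) bij.
have tr (m : 'I_(k.+1 ^ n).+1) :
    val (box m b) = Num.trunc (K * fr m 0 b).
  rewrite ffunE /= inordK// -(ltr_nat R) (@le_lt_trans _ _ (K * fr m 0 b))//.
    by rewrite truncn_le mulr_ge0// ltW.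
  by rewrite gtr_pMr.
rewrite !tr => E.
have b1 m : (Num.trunc (K * fr m 0 b))%:R <= K * fr m 0 b <
    (Num.trunc (K * fr m 0 b))%:R + 1.
  rewrite natr1; apply: truncn_itv.
  by rewrite mulr_ge0// ltW.
have := b1 i; have := b1 j; rewrite E.
move: (_%:R) => q /andP[j1 j2] /andP[i1 i2].
rewrite -[K^-1]mul1r ler_pdivlMr// mulrC -[K in K * _]gtr0_norm// -normrM.
by rewrite ler_norml mulrBr; apply/andP; split; lra.
Qed.

End Dirichlet.

(** * Lattice points near a ray *)

Section Residue.
Context {R : realType} {n : nat}.

(** Since [u *m pinvmx W *m W = u] for [u] in the row space of [W], this is a
    linear map killing that space and moving vectors only along it. *)
Definition residue m (W : 'M[R]_(m, n)) (x : 'rV[R]_n) :=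
  x *m (1%:M - pinvmx W *m W).

Lemma residue_sub m (W : 'M[R]_(m, n)) x : (x - residue W x <= W)%MS.
Proof.
by rewrite /residue mulmxBr mulmx1 subKr mulmxA submxMl.
Qed.

Lemma residue0 m (W : 'M[R]_(m, n)) x : (x <= W)%MS -> residue W x = 0.
Proof.
by move=> xW; rewrite /residue mulmxBr mulmx1 mulmxA mulmxKpV ?subrr.
Qed.

Lemma residue_eq m (W : 'M[R]_(m, n)) x y :
  (x - y <= W)%MS -> residue W x = residue W y.
Proof.
by move=> /residue0 /eqP; rewrite /residue mulmxBl subr_eq0 => /eqP.
Qed.

Lemma residue_bounded m (W : 'M[R]_(m, n)) :
  exists2 c : R, 0 < c & forall x, `|residue W x| <= c * `|x|.
Proof.
have [c c0 cM] := mulmx_bounded (1%:M - pinvmx W *m W).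
by exists c => // x; exact: cM.
Qed.

Lemma sub_col_mxl p q (A : 'M[R]_(p, n)) (B : 'M[R]_(q, n)) :
  (A <= col_mx A B)%MS.
Proof. by rewrite -addsmxE addsmxSl. Qed.

Lemma sub_col_mxr p q (A : 'M[R]_(p, n)) (B : 'M[R]_(q, n)) :
  (B <= col_mx A B)%MS.
Proof. by rewrite -addsmxE addsmxSr. Qed.

(** Rows are added as long as they raise the rank.  The bound [n] on their
    number does not depend on [S]; it bounds the rounding errors of
    [lift_mod]. *)
Lemma row_span (S : set 'rV[R]_n) m (W : 'M[R]_(m, n)) :
  exists k (H : 'M[R]_(k, n)), [/\ (k <= n)%N, forall i, S (row i H) &
    forall s, S s -> (s <= col_mx H W)%MS].
Proof.
suff H d : forall m (W : 'M[R]_(m, n)), (n <= d + \rank W)%N ->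
  exists k (H : 'M[R]_(k, n)), [/\ (k <= d)%N, forall i, S (row i H) &
    forall s, S s -> (s <= col_mx H W)%MS].
  by apply: H; rewrite leq_addr.
elim: d => [|d IH] {}m {}W rW.
  exists 0, 0; split=> // [[]//|s _].
  rewrite submx_full// -col_leq_rank (leq_trans rW)// mxrankS//.
  by rewrite sub_col_mxr.
have [SW|] := pselect (forall s, S s -> (s <= W)%MS).
  exists 0, 0; split=> // [[]//|s /SW sW].
  by rewrite (submx_trans sW)// sub_col_mxr.
move=> /existsNP[s /not_implyP[Ss /negP sW]].
have Wlt : (W < col_mx s W)%MS.
  rewrite ltmxE -!addsmxE addsmxSr addsmx_sub submx_refl andbT.
  exact: sW.
have [|k [H [kd SH spanH]]] := IH _ (col_mx s W).
  by rewrite (leq_trans rW)// addSnnS leq_add2l rank_ltmx.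
exists (k + 1)%N, (col_mx H s); split=> [|i|s' /spanH].
- by rewrite addn1.
- case: (split_ordP i) => j ->; first by rewrite rowKu.
  by rewrite rowKd row_id.
move/submx_trans; apply; rewrite !col_mx_sub; apply/and3P; split.
- by rewrite (submx_trans _ (sub_col_mxl _ _))// sub_col_mxl.
- by rewrite (submx_trans _ (sub_col_mxl _ _))// sub_col_mxr.
- by rewrite sub_col_mxr.
Qed.

End Residue.

Section Directions.
Context {R : realType} {n : nat}.
Implicit Types (A : set 'rV[R]_n) (w l u : 'rV[R]_n).

Definition near_ray w e : set 'rV[R]_n :=
  [set l | intmx l /\ exists2 t, 0 <= t & `|l - t *: w| < e].

(** The span modulo [W] of the integral vectors within [e] of the ray through
    [w] shrinks with [e], so its rank is constant for small [e] and the span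
    itself is then a fixed space [W1].  By Dirichlet's theorem [W1] contains
    vectors within [e0] of arbitrarily remote points of the ray, so [w] lies
    in [W1]. *)
Lemma near_ray_span w m (W : 'M[R]_(m, n)) :
  exists e0 k0 (H0 : 'M[R]_(k0, n)), let W1 := col_mx H0 W in
  [/\ 0 < e0, intmx H0, (w <= W1)%MS,
      forall l, near_ray w e0 l -> (l <= W1)%MS &
      forall e, 0 < e -> exists k (H : 'M[R]_(k, n)),
        [/\ (k <= n)%N, forall i, near_ray w e (row i H),
            (H <= W1)%MS & (W1 <= col_mx H W)%MS] ].
Proof.
pose P r := exists e k (H : 'M[R]_(k, n)), [/\ 0 < e, \rank (col_mx H W) = r,
  forall i, near_ray w e (row i H) &
  forall l, near_ray w e l -> (l <= col_mx H W)%MS].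
have exP : exists r, `[< P r >].
  have [k [H [_ wH spanH]]] := row_span (near_ray w 1) W.
  by exists (\rank (col_mx H W)); apply/asboolP; exists 1, k, H; split.
case: (ex_minnP exP) => r /asboolP[e0 [k0 [H0 [e00 rH wH0 spanH0]]]] rmin.
exists e0, k0, H0 => W1; split=> //.
- apply/mxOverP => i j; have [/mxOverP/(_ 0 j)] := wH0 i.
  by rewrite mxE.
- have [c c0 cW] := residue_bounded W1.
  suff : residue W1 w == 0.
    by move=> /eqP w0; have := residue_sub W1 w; rewrite w0 subr0.
  apply/negPn/negP; rewrite -normr_gt0 => w0.
  have [l [t [li tT lt]]] :=
    dirichlet w ((c * e0) / `|residue W1 w| + 1) e00.
  have t0 : 0 < t.
    by apply: lt_le_trans tT; rewrite ltr_wpDl// divr_ge0 ?mulr_ge0 ?ltW.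
  have lW : (l <= W1)%MS by apply: spanH0; split=> //; exists t; rewrite ?ltW.
  have := cW (l - t *: w); rewrite /residue mulmxBl -/(residue W1 l).
  rewrite residue0// sub0r normrN -scalemxAl normrZ gtr0_norm// => tw.
  have : t * `|residue W1 w| <= c * e0.
    by rewrite (le_trans tw)// ler_wpM2l ?ltW.
  rewrite -ler_pdivlMr// leNgt => /negP; apply.
  by apply: lt_le_trans tT; rewrite ltrDl.
- move=> e e_gt0.
  have [k [H [kn wH spanH]]] := row_span (near_ray w (Num.min e e0)) W.
  have sub e' : Num.min e e0 <= e' ->
      near_ray w (Num.min e e0) `<=` near_ray w e'.
    move=> ee l [li [t t0 lt]]; split=> //; exists t => //.
    exact: lt_le_trans ee.
  have HW1 : (H <= W1)%MS.
    apply/row_subP => i; apply/spanH0/(sub e0)/wH.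
    by rewrite ge_min lexx orbT.
  exists k, H; split=> //.
    by move=> i; apply/(sub e)/wH; rewrite ge_min lexx.
  have HWW1 : (col_mx H W <= W1)%MS.
    by rewrite col_mx_sub HW1 sub_col_mxr.
  rewrite -(mxrank_leqif_sup HWW1) eqn_leq mxrankS//= rH.
  apply: rmin; apply/asboolP; exists (Num.min e e0), k, H; split=> //.
  by rewrite lt_min e_gt0.
Qed.

Lemma open_has_ball A : open A ->
  forall a, A a -> exists2 r : R, 0 < r & forall u, `|u| < r -> A (a + u).
Proof.
move=> oA a Aa; have /nbhs_ballP[r /= r0 rA] := open_nbhs_nbhs (conj oA Aa).
exists r => // u ur; apply: rA; rewrite mx_norm_ball /ball_ /=.
by rewrite opprD addNKr normrN.
Qed.

Lemma has_ball_open A :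
  (forall a, A a -> exists2 r : R, 0 < r & forall u, `|u| < r -> A (a + u)) ->
  open A.
Proof.
move=> H; rewrite openE => a /H[r r0 rA]; apply/nbhs_ballP; exists r => // y.
rewrite mx_norm_ball /ball_ /= distrC => /rA.
by rewrite addrC subrK.
Qed.

Lemma convex_set_comb A (a b : 'rV[R]_n) (s t : R) :
  convex_set A -> 0 <= s -> 0 <= t -> s + t = 1 ->
  A a -> A b -> A (s *: a + t *: b).
Proof.
move=> cA s0 t0 st Aa Ab.
have s1 : s <= 1 by rewrite -st lerDl.
have := cA a b (Itv01 s0 s1) (mem_set Aa) (mem_set Ab).
by rewrite inE /conv /= /unstable.onem -st addrAC subrr add0r.
Qed.

Lemma comb_convex_set A :
  (forall (a b : 'rV[R]_n) (s t : R), 0 <= s -> 0 <= t -> s + t = 1 ->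
    A a -> A b -> A (s *: a + t *: b)) -> convex_set A.
Proof.
move=> cA x y k; rewrite !inE => Ax Ay; apply: cA => //.
  by rewrite /unstable.onem subr_ge0.
by rewrite /unstable.onem addrC subrK.
Qed.

(** Since [A] is open, it contains [(1 + h) *: a] for a small [h > 0], and [a]
    plus a point of the tube is a convex combination of this point with a
    multiple of a point of the tube at the origin; the latter is the midpoint of
    a point of the ray and of a point of a ball around 0. *)
Lemma ray_tube A w : open A -> convex_set A -> A 0 ->
  (forall t, 0 <= t -> A (t *: w)) -> forall a, A a ->
  exists2 r, 0 < r & forall t u, 0 <= t -> `|u| < r -> A (a + (t *: w + u)).
Proof.
move=> oA cA A0 Aw a Aa.
have [r0 r00 Ar0] := open_has_ball oA A0.
have [ra ra0 Ara] := open_has_ball oA Aa.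
have na : 0 < `|a| + 1 by rewrite ltr_wpDl.
pose h := ra / (2 * (`|a| + 1)).
have h0 : 0 < h by rewrite divr_gt0// mulr_gt0.
have Aha : A ((1 + h) *: a).
  rewrite scalerDl scale1r; apply: Ara; rewrite normrZ gtr0_norm//.
  rewrite /h mulrAC ltr_pdivrMr ?mulr_gt0//; have := normr_ge0 a; nra.
have h1 : 0 < 1 + h by rewrite addr_gt0.
pose q := 2 * (1 + h) / h.
have q0 : 0 < q by rewrite divr_gt0// mulr_gt0.
exists (r0 / q) => [|t u t0 ur]; first by rewrite divr_gt0.
have Au : A (q *: u).
  rewrite -[_ *: _]add0r; apply: Ar0.
  by rewrite normrZ gtr0_norm// mulrC -ltr_pdivlMr.
have Atw : A ((q * t) *: w) by apply: Aw; rewrite mulr_ge0// ltW.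
have half : 0 <= 1 / 2 :> R by rewrite divr_ge0.
have Atu := convex_set_comb cA half half (esym (splitr 1)) Atw Au.
have h10 : 0 <= (1 + h)^-1 by rewrite invr_ge0 ltW.
have hh0 : 0 <= h / (1 + h) by rewrite divr_ge0 ?ltW.
have s1 : (1 + h)^-1 + h / (1 + h) = 1 by field; lra.
suff -> : a + (t *: w + u) = (1 + h)^-1 *: ((1 + h) *: a)
    + h / (1 + h) *: (1 / 2 *: ((q * t) *: w) + 1 / 2 *: (q *: u)).
  exact: (convex_set_comb cA h10 hh0 s1).
apply/rowP => i; rewrite !mxE /q; field; lra.
Qed.

End Directions.

(** * Cones of lattice points around a recession direction *)

Section Generation.
Context {R : realType} {n : nat}.
Implicit Types (A : set 'rV[R]_n) (w l u x f : 'rV[R]_n).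

Definition lattice_points A (N : R) : set 'rV[R]_n :=
  [set f | [/\ intmx f, A f & `|f| <= N]].

Lemma lattice_points_sub A N N' :
  N <= N' -> lattice_points A N `<=` lattice_points A N'.
Proof. by move=> NN f [fi Af fN]; split=> //; apply: le_trans NN. Qed.

Lemma finite_lattice_points A N : finite_set (lattice_points A N).
Proof.
by apply: sub_finite_set (finite_int_ball n N) => f [fi _ fN].
Qed.

Definition translation_invariant A m (W : 'M[R]_(m, n)) :=
  forall a y, A a -> (y <= W)%MS -> A (a + y).

(** Finite generation modulo [W], in the quantitative form that makes the
    induction work; [x] is any representative of [l] modulo [W], so that [c] is
    controlled by the distance from [l] to the row space of [W]. *)
Definition generated_mod A m (W : 'M[R]_(m, n)) :=
  exists2 N, 0 <= N & forall x l, intmx l -> A l -> (x - l <= W)%MS ->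
    exists c z, [/\ comb (lattice_points A N) c z, c <= N * `|x| &
      (x - z <= W)%MS].

(** The Minkowski sum of [A] and the row space of [W]. *)
Definition thicken A m (W : 'M[R]_(m, n)) : set 'rV[R]_n :=
  [set x | exists2 y, (y <= W)%MS & A (x - y)].

Section Thicken.
Context (A : set 'rV[R]_n) (m : nat) (W : 'M[R]_(m, n)).

Lemma sub_thicken : A `<=` thicken A W.
Proof. by move=> a Aa; exists 0; rewrite ?subr0 ?sub0mx. Qed.

Lemma thicken_open : open A -> open (thicken A W).
Proof.
move=> oA; apply: has_ball_open => x [y yW /(open_has_ball oA)[r r0 rA]].
exists r => // u /rA ?; exists y => //.
by rewrite addrAC.
Qed.

Lemma thicken_convex : convex_set A -> convex_set (thicken A W).
Proof.
move=> cA; apply: comb_convex_set => x x' s t s0 t0 st [y yW Ay] [y' yW' Ay'].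
exists (s *: y + t *: y'); first by rewrite addmx_sub ?scalemx_sub.
by rewrite opprD addrACA -!scalerBr; apply: convex_set_comb.
Qed.

Lemma thicken_invariant : translation_invariant (thicken A W) W.
Proof.
move=> a y [z zW Az] yW; exists (z + y); first by rewrite addmx_sub.
by rewrite opprD addrACA subrr addr0.
Qed.

End Thicken.

Section Direction.
Context (A : set 'rV[R]_n) (m : nat) (W : 'M[R]_(m, n)) (w : 'rV[R]_n).
Hypotheses (A_open : open A) (A_convex : convex_set A) (A0 : A 0).
Hypothesis AW : translation_invariant A W.
Hypothesis (Aw : forall t, 0 <= t -> A (t *: w)).

Context (k0 : nat) (H0 : 'M[R]_(k0, n)) (e0 : R).
Let W1 := col_mx H0 W.
Hypothesis e0_gt0 : 0 < e0.
Hypothesis wW1 : (w <= W1)%MS.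
Hypothesis near_W1 : forall l, near_ray w e0 l -> (l <= W1)%MS.
Hypothesis W1_near : forall e, 0 < e -> exists k (H : 'M[R]_(k, n)),
  [/\ (k <= n)%N, forall i, near_ray w e (row i H),
      (H <= W1)%MS & (W1 <= col_mx H W)%MS].

(** Write [f = a + y] with [a] in [A] and [y] in [W1], and expand [y] modulo [W]
    over integral vectors close to the ray.  Rounding its coefficients down to
    integers leaves [a] plus a combination of vectors close to the ray with
    coefficients in [0, 1): a point of the tube issued from [a]. *)
Lemma lift_mod f : intmx f -> thicken A W1 f ->
  exists f', [/\ intmx f', A f' & (f - f' <= W1)%MS].
Proof.
move=> fi [y yW1 Aa]; set a := f - y in Aa.
have [r r0 rA] := ray_tube A_open A_convex A0 Aw Aa.
pose e := r / n.+1%:R.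
have e_gt0 : 0 < e by rewrite divr_gt0.
have [k [H [kn Hw HW1 W1H]]] := W1_near e_gt0.
have /choice[t tP] i : exists t, 0 <= t /\ `|row i H - t *: w| < e.
  by have [_ [t t0 te]] := Hw i; exists t.
have Hi : intmx H.
  by apply/mxOverP => i j; have [/mxOverP/(_ 0 j)] := Hw i; rewrite mxE.
have /submxP[ab yE] := submx_trans yW1 W1H.
rewrite -[ab]hsubmxK mul_row_col in yE.
set b := lsubmx ab in yE.
exists (f - floormx b *m H); split.
- by apply: intmxB => //; apply: intmxM => //; exact: floormx_int.
- set g := b - floormx b.
  have -> : f - floormx b *m H = (a + g *m H) + rsubmx ab *m W.
    rewrite /g /a mulmxBl yE.
    move: (b *m H) (floormx b *m H) (rsubmx ab *m W) => *.
    by apply/rowP => i; rewrite !mxE; ring.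
  apply: AW; last exact: submxMl.
  pose s := \sum_i g 0 i * t i.
  have -> : g *m H = s *: w + (g *m H - s *: w) by rewrite addrC subrK.
  apply: rA.
    by apply: sumr_ge0 => i _; rewrite mulr_ge0 ?fracmx_ge0//; case: (tP i).
  have -> : g *m H - s *: w = \sum_i g 0 i *: (row i H - t i *: w).
    rewrite mulmx_sum_row /s scaler_suml -sumrB.
    by apply: eq_bigr => i _; rewrite scalerBr scalerA.
  apply: le_lt_trans (ler_norm_sum _ _ _) _.
  apply: (@le_lt_trans _ _ (\sum_(i < k) e)).
    apply: ler_sum => i _; rewrite normrZ -[e]mul1r ler_pM//.
      by rewrite ger0_norm ?fracmx_ge0// ltW ?fracmx_lt1.
    by rewrite ltW//; case: (tP i).
  rewrite sumr_const card_ord -mulr_natr /e mulrAC ltr_pdivrMr//.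
  by rewrite ltr_pM2l// ltr_nat ltnS.
- rewrite opprB addrC subrK.
  exact: submx_trans (submxMl _ _) HW1.
Qed.

(** Take [H] spanning [W1] modulo [W], and [l] much further along the ray and
    much closer to it than the rows of [H].  All of the rows, [l] and the
    differences of [l] and a row lie in [A].  As [l] is the sum of any row and
    the corresponding difference, the cone over these vectors contains
    [l + a *m H] for all small [a], positive or not; and [t *: w] differs from
    [l] by a small element of [W1]. *)
Lemma cone_nbhd : exists N h, 0 < h /\ forall u, (u <= W1)%MS -> `|u| < h ->
  exists c z, [/\ comb (lattice_points A N) c z, c <= N & (w + u - z <= W)%MS].
Proof.
have [r r0 rA] := ray_tube A_open A_convex A0 Aw A0.
have tube t l : 0 <= t -> `|l - t *: w| < r -> A l.
  move=> t0 lr; have := rA _ _ t0 lr.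
  by rewrite add0r addrC subrK.
have r2 : 0 < r / 2 by rewrite divr_gt0.
have [k [H [_ Hw HW1 W1H]]] := W1_near r2.
have /choice[tt tP] i : exists t, 0 <= t /\ `|row i H - t *: w| < r / 2.
  by have [_ [t t0 te]] := Hw i; exists t.
have Hi i : intmx (row i H) by have [] := Hw i.
have [c c0 cP] := mulmx_bounded (pinvmx (col_mx H W)).
pose q : R := k.+1%:R^-1.
have q0 : 0 < q by rewrite invr_gt0.
pose rho := Num.min (r / 2) (Num.min e0 (q / (2 * c))).
have qc0 : 0 < q / (2 * c) by rewrite divr_gt0// mulr_gt0.
have rho0 : 0 < rho by rewrite !lt_min r2 e0_gt0.
have [rho1 rho2 rho3] : [/\ rho <= r / 2, rho <= e0 & rho <= q / (2 * c)].
  by rewrite /rho !ge_min !lexx !orbT.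
have [l [t [li tT lt]]] := dirichlet w (1 + \sum_i tt i) rho0.
have S0 : 0 <= \sum_i tt i by apply: sumr_ge0 => i _; case: (tP i).
have t1 : 1 <= t by apply: le_trans tT; rewrite lerDl.
have t0 : 0 < t by apply: lt_le_trans t1.
have ttt i : tt i <= t.
  apply: le_trans tT; rewrite (bigD1 i)//= addrCA lerDl addr_ge0//.
  by apply: sumr_ge0 => j _; case: (tP j).
have lW1 : (l <= W1)%MS.
  by apply: near_W1; split=> //; exists t; [exact: ltW|exact: lt_le_trans rho2].
have lA : A l by apply: (tube t); [exact: ltW|apply: lt_le_trans lt _; lra].
(* 3 bounds the total weight of the combination [z0] below. *)
pose N := Num.max 3 (`|l| + `|H|).
have N3 : 3 <= N by rewrite /N le_max lexx.
have lHN : `|l| + `|H| <= N by rewrite /N le_max lexx orbT.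
have lN : lattice_points A N l.
  by split=> //; apply: le_trans lHN; rewrite lerDl.
have HN i : lattice_points A N (row i H).
  have [ti rt] := tP i.
  split=> //; first by apply: (tube (tt i)) => //; lra.
  apply: le_trans lHN; rewrite (le_trans (row_le_norm _ _))// lerDr//.
have lHN' i : lattice_points A N (l - row i H).
  have [ti rt] := tP i.
  split; first exact: intmxB.
    apply: (tube (t - tt i)); first by rewrite subr_ge0.
    have -> : l - row i H - (t - tt i) *: w =
        (l - t *: w) - (row i H - tt i *: w).
      by apply/rowP => j; rewrite !mxE; ring.
    by rewrite (le_lt_trans (ler_normB _ _))//; lra.
  apply: le_trans lHN; rewrite (le_trans (ler_normB _ _))// lerD2l.
  exact: row_le_norm.
exists N, (q / (2 * c) / t); split; first by rewrite divr_gt0.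
move=> u uW1 ut.
pose v := t *: u - (l - t *: w).
have vW1 : (v <= W1)%MS.
  by rewrite addmx_sub ?scalemx_sub// eqmx_opp addmx_sub// eqmx_opp scalemx_sub.
have vq : `|v| <= q / c.
  rewrite (le_trans (ler_normB _ _))// normrZ gtr0_norm//.
  rewrite ltr_pdivlMr// mulrC in ut.
  have -> : q / c = q / (2 * c) + q / (2 * c) by field; lra.
  by apply: lerD; [exact: ltW|rewrite (le_trans (ltW lt))].
pose ab := v *m pinvmx (col_mx H W).
have vE : v = lsubmx ab *m H + rsubmx ab *m W.
  rewrite -mul_row_col hsubmxK mulmxKpV//; exact: (submx_trans vW1 W1H).
have abq : `|ab| <= q.
  by rewrite (le_trans (cP _ _))// mulrC -ler_pdivlMr.
clearbody ab; set a := lsubmx ab in vE.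
have /all_and2[aqN aq] i : - q <= a 0 i /\ a 0 i <= q.
  by apply/andP; rewrite -ler_norml mxE (le_trans (entry_le_norm _ _ _)).
pose z0 := \sum_i ((q + a 0 i) *: row i H + q *: (l - row i H)) + q *: l.
pose c0' := \sum_i ((q + a 0 i) + q) + q.
have cz : comb (lattice_points A N) c0' z0.
  apply: comb_add; last by apply: comb_atom => //; exact: ltW.
  apply: comb_sum => i; apply: comb_add; apply: comb_atom => //.
    by have := aqN i; lra.
  exact: ltW.
have kq : k.+1%:R * q = 1 by rewrite mulfV.
have z0E : z0 = l + a *m H.
  rewrite /z0 (eq_bigr (fun i => q *: l + a 0 i *: row i H)); last first.
    by move=> i _; apply/rowP => j; rewrite !mxE; ring.
  rewrite big_split /= sumr_const card_ord -mulmx_sum_row.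
  rewrite -scaler_nat scalerA addrAC -scalerDl -{2}[q]mul1r -mulrDl.
  by rewrite -natr1 in kq; rewrite kq scale1r.
have c03 : c0' <= 3.
  apply: (@le_trans _ _ (\sum_(i < k) 3 * q + q)).
    by rewrite lerD2r; apply: ler_sum => i _; have := aq i; lra.
  rewrite sumr_const card_ord -mulr_natl.
  rewrite -natr1 in kq; nra.
exists (t^-1 * c0'), (t^-1 *: z0); split.
- by apply: comb_scale => //; rewrite invr_ge0 ltW.
- apply: le_trans N3; apply: le_trans c03; rewrite ler_piMl//.
    exact: comb_ge0 cz.
  by rewrite invf_le1.
- suff -> : w + u - t^-1 *: z0 = t^-1 *: (rsubmx ab *m W).
    by rewrite scalemx_sub// submxMl.
  have -> : rsubmx ab *m W = t *: (w + u) - z0.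
    rewrite z0E -[RHS]addr0 -(subrr v) {1}vE /v -/a.
    move: (a *m H) (rsubmx ab *m W) => aH bW.
    by apply/rowP => i; rewrite !mxE; ring.
  by rewrite scalerBr scalerA mulVf ?gt_eqF// scale1r.
Qed.

End Direction.
End Generation.

(** * Finite generation of the cone of lattice points of a convex set *)

Section Generation.
Context {R : realType} {n : nat}.
Implicit Types (A : set 'rV[R]_n) (w l u x f : 'rV[R]_n).

Lemma upper_bound3 (a b c : R) : exists N, [/\ a <= N, b <= N & c <= N].
Proof. by exists (Num.max a (Num.max b c)); rewrite !le_max !lexx !orbT. Qed.

Section Direction.
Context (A : set 'rV[R]_n) (m : nat) (W : 'M[R]_(m, n)).
Hypotheses (A_open : open A) (A_convex : convex_set A) (A0 : A 0).
Hypotheses (W_int : intmx W) (AW : translation_invariant A W).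

(** Let the integral vector [l] be equal to [s *: w'] modulo [W], with [w']
    close to [w].  Modulo [W1] it is [s *: (w' - w)], which is small compared
    with [s]; so the lifts of the generators modulo [W1] account for it up to
    [W1] with coefficients small compared with [s], and the remainder is [s]
    times an element of [W1] close to [w]. *)
Lemma generated_near_recession w : (forall t, 0 <= t -> A (t *: w)) ->
  ~~ (w <= W)%MS ->
  (forall m' (W' : 'M[R]_(m', n)), intmx W' -> (\rank W < \rank W')%N ->
    generated_mod (thicken A W') W') ->
  exists N d, 0 < d /\ forall w' s l, `|w' - w| < d -> 0 < s ->
    intmx l -> A l -> (s *: w' - l <= W)%MS ->
    exists c z, [/\ comb (lattice_points A N) c z, c <= N * s &
      (s *: w' - z <= W)%MS].
Proof.
move=> Aw wW IH.
have [e0 [k0 [H0 [e00 H0i wW1 nearW1 W1near]]]] := near_ray_span w W.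
set W1 := col_mx H0 W in wW1 nearW1 W1near.
have W1i : intmx W1.
  apply/mxOverP => i j; case: (split_ordP i) => k ->.
    by rewrite col_mxEu (mxOverP H0i).
  by rewrite col_mxEd (mxOverP W_int).
have WW1 : (W < W1)%MS.
  rewrite ltmxE sub_col_mxr; apply/negP => W1W; move/negP: wW; apply.
  exact: submx_trans wW1 W1W.
have [N1 N10 gen1] := IH _ W1 W1i (rank_ltmx WW1).
have [N2 [h [h0 nbhd]]] :=
  cone_nbhd A_open A_convex A0 Aw e00 wW1 nearW1 W1near.
have [N3 lift] : exists N, forall f, lattice_points (thicken A W1) N1 f ->
    exists2 f', lattice_points A N f' & (f - f' <= W1)%MS.
  apply: (@finite_uniform R _ _
    (fun f N => exists2 f', lattice_points A N f' & _)).
  - exact: finite_lattice_points.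
  - move=> f N N' NN [f' f'N ?]; exists f' => //.
    exact: lattice_points_sub f'N.
  - move=> f [fi Af _].
    have [f' [f'i Af' ff']] :=
      lift_mod A_open A_convex A0 AW Aw W1near fi Af.
    by exists `|f'|, f'.
pose N4 := Num.max N3 0.
have N40 : 0 <= N4 by rewrite le_max lexx orbT.
have N34 : N3 <= N4 by rewrite le_max lexx.
have [N [NN4 NN2 NN12]] := upper_bound3 N4 N2 (N1 + N2).
pose q := 1 + N1 * N4.
have q0 : 0 < q by rewrite ltr_wpDr// mulr_ge0.
pose d := Num.min 1 (h / q).
have d0 : 0 < d by rewrite lt_min ltr01 divr_gt0.
have [d1 dq] : d <= 1 /\ d <= h / q by split; rewrite /d !ge_min !lexx ?orbT.
exists N, d; split=> // w' s l w'd s0 li Al lW.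
pose x := s *: (w' - w).
have xn : `|x| = s * `|w' - w| by rewrite normrZ gtr0_norm.
have xW1 : (x - l <= W1)%MS.
  have -> : x - l = (s *: w' - l) - s *: w.
    by apply/rowP => j; rewrite !mxE; ring.
  rewrite addmx_sub//; first exact: submx_trans lW (sub_col_mxr _ _).
  by rewrite eqmx_opp scalemx_sub.
have [c1 [z1 [cz1 c1x xz1]]] := gen1 x l li (@sub_thicken _ _ A _ W1 l Al) xW1.
have [z1' cz1' zz1] := comb_transfer lift cz1.
have z1n : `|z1'| <= c1 * N4.
  by apply: (comb_norm _ cz1') => f [_ _ fN]; exact: le_trans N34.
pose u := s^-1 *: (x - z1').
have uW1 : (u <= W1)%MS.
  by rewrite scalemx_sub// -[x](subrK z1) -addrA addmx_sub.
have uh : `|u| < h.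
  rewrite normrZ gtr0_norm ?invr_gt0// mulrC ltr_pdivrMr//.
  apply: le_lt_trans (ler_normB _ _) _; rewrite xn.
  have w'q : `|w' - w| * q < h.
    by rewrite -ltr_pdivlMr//; apply: lt_le_trans dq.
  have : c1 * N4 <= (N1 * (s * `|w' - w|)) * N4.
    by rewrite ler_wpM2r// -xn.
  rewrite /q in w'q; nra.
have [c2 [z2 [cz2 c2N uz2]]] := nbhd u uW1 uh.
exists (c1 + s * c2), (z1' + s *: z2); split.
- apply: comb_add.
    by apply: comb_sub cz1'; apply: lattice_points_sub; lra.
  apply: comb_scale; first exact: ltW.
  by apply: comb_sub cz2; apply: lattice_points_sub; lra.
- have w'1 : `|w' - w| <= 1 by apply: le_trans d1; exact: ltW.
  apply: (@le_trans _ _ (N1 * s + s * N2)); last first.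
    by rewrite [s * _]mulrC -mulrDl ler_wpM2r// ltW.
  apply: lerD; last by rewrite ler_wpM2l// ltW.
  apply: le_trans c1x _; rewrite ler_wpM2l// xn ler_piMr// ltW//.
- have -> : s *: w' - (z1' + s *: z2) = s *: (w + u - z2).
    rewrite !scalerBr scalerDr /u scalerA mulfV ?gt_eqF// scale1r /x.
    by apply/rowP => j; rewrite !mxE; ring.
  by rewrite scalemx_sub.
Qed.

(** Modulo [W] there are only finitely many integral vectors of bounded residue,
    since each of them can be moved by integral combinations of the rows of [W]
    into a fixed ball.  Their nonzero residues are bounded below, so the weight
    1 is at most a constant times the norm. *)
Lemma generated_bounded M : exists N, forall x l, intmx l -> A l ->
  (x - l <= W)%MS -> residue W x = x -> `|x| <= M ->
  exists c z, [/\ comb (lattice_points A N) c z, c <= N * `|x| &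
    (x - z <= W)%MS].
Proof.
pose B := M + m%:R * `|W|.
have [N NP] : exists N, forall f, lattice_points A B f ->
    residue W f != 0 -> 1 <= N * `|residue W f|.
  apply: (@finite_uniform R _ _ (fun f N => _ -> 1 <= N * _)).
  - exact: finite_lattice_points.
  - by move=> f N N' NN fN /fN /le_trans; apply; rewrite ler_wpM2r.
  - move=> f _; exists `|residue W f|^-1 => f0.
    by rewrite mulVf// normr_eq0.
exists (Num.max B N) => x l li Al xl xE xM.
have [x0|x0] := eqVneq x 0.
  exists 0, 0; rewrite subr0 x0 normr0 mulr0 sub0mx; split=> //.
  exact: comb_nil.
have /submxP[b bE] := xl.
pose l' := l + floormx b *m W.
have xl' : x - l' = (b - floormx b) *m W.
  by rewrite mulmxBl -bE /l' opprD addrA.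
have l'B : lattice_points A B l'.
  split.
  - by apply: intmxD => //; apply: intmxM => //; exact: floormx_int.
  - by apply: AW => //; exact: submxMl.
  - rewrite -[l'](subKr x) xl' (le_trans (ler_normB _ _))// lerD//.
    apply: le_trans (mulmx_le_norm _ _) _.
    rewrite ler_wpM2l// -[leRHS]mul1r ler_wpM2r//.
    exact: fracmx_norm.
have xl'W : (x - l' <= W)%MS by rewrite xl' submxMl.
have res_l' : residue W l' = x by rewrite -(residue_eq xl'W).
exists 1, l'; split=> //.
  rewrite -[l']scale1r; apply: comb_atom => //.
  by apply: lattice_points_sub l'B; rewrite le_max lexx.
have := NP l' l'B; rewrite res_l' => /(_ x0) /le_trans; apply.
by rewrite ler_wpM2r// le_max lexx orbT.
Qed.

End Direction.

(** Induction on the codimension of [W], with compactness of the unit sphere to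
    treat all directions with one bound [N]. *)
Lemma int_cone_generated A m (W : 'M[R]_(m, n)) :
  open A -> convex_set A -> A 0 -> intmx W -> translation_invariant A W ->
  generated_mod A W.
Proof.
move: {2}(n - \rank W)%N (leqnn (n - \rank W)%N) => d.
elim: d => [|d IH] in A m W *; rewrite leq_subLR => rW oA cA A0 Wi AW.
  exists 0 => // x l _ _ _; exists 0, 0; rewrite mul0r subr0.
  split=> //; first exact: comb_nil.
  by rewrite submx_full// -col_leq_rank (leq_trans rW)// addn0.
pose Q (N : R) w := forall s l, N <= s -> 0 < s -> residue W w = w ->
  `|w| = 1 -> intmx l -> A l -> (s *: w - l <= W)%MS ->
  exists c z, [/\ comb (lattice_points A N) c z, c <= N * s &
    (s *: w - z <= W)%MS].
have : \forall N \near +oo%R, [set w : 'rV[R]_n | `|w| = 1] `<=` Q N.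
  have /compact_near_coveringP := @unit_sphere_compact R n.
  apply => w /= w1.
  have [ray|] := pselect (forall t, 0 <= t -> A (t *: w)); last first.
    move=> /existsNP[t /not_implyP[t0 Atw]].
    have [r r0 rA] := open_has_ball oA A0.
    have q0 : 0 < r / (2 * (t + 1)) by rewrite divr_gt0// mulr_gt0// ltr_wpDl.
    exists ([set w' | `|w' - w| < r / (2 * (t + 1))],
      [set N | 2 * (t + 1) < N]).
      split; first exact: near_norm.
      by apply: nbhs_pinfty_gt; rewrite num_real.
    move=> [w' N] /= [w'w Nt] s l Ns s0 _ _ _ Al wl; exfalso; apply: Atw.
    have Asw : A (s *: w').
      by rewrite -[_ *: _](subrK l) addrC; exact: AW.
    have As0 : 0 <= 2 * t / s by rewrite divr_ge0 ?mulr_ge0// ltW.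
    have As1 : 0 <= 1 - 2 * t / s by rewrite subr_ge0 ler_pdivrMr//; lra.
    (* [t *: w] is the midpoint of [(2 * t) *: w'], which lies on the segment
       from 0 to [s *: w'], and of a small vector. *)
    have A1 : A ((2 * t) *: w').
      have s1 : 2 * t / s + (1 - 2 * t / s) = 1 by rewrite addrC subrK.
      have := convex_set_comb cA As0 As1 s1 Asw A0.
      by rewrite scaler0 addr0 scalerA divfK// gt_eqF.
    have A2 : A ((2 * t) *: (w - w')).
      rewrite -[_ *: _]add0r; apply: rA; rewrite normrZ ger0_norm ?mulr_ge0//.
      rewrite distrC ltr_pdivlMr ?mulr_gt0// in w'w; last by lra.
      have := normr_ge0 (w - w'); nra.
    have half : 0 <= 1 / 2 :> R by rewrite divr_ge0.
    suff -> : t *: w =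
        1 / 2 *: ((2 * t) *: w') + 1 / 2 *: ((2 * t) *: (w - w')).
      exact: (convex_set_comb cA half half (esym (splitr 1))).
    by apply/rowP => j; rewrite !mxE; field.
  (* A direction lying in [W] has no fixed points of [residue W] near it. *)
  have [wW|wW] := boolP (w <= W)%MS.
    have [c c0 cW] := residue_bounded W.
    exists ([set w' | `|w' - w| < c^-1], setT).
      by split; [apply: near_norm; rewrite invr_gt0|exact: filterT].
    move=> [w' N] /= [w'w _] s l _ _ w'E w'1 _ _ _.
    have := cW (w' - w); rewrite /residue mulmxBl -!/(residue W _).
    rewrite w'E residue0// subr0 w'1 leNgt => /negP; case.
    by rewrite mulrC -ltr_pdivlMr// mul1r.
  have [|N [e [e0 Ne]]] := generated_near_recession oA cA A0 Wi AW ray wW.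
    move=> m' W' W'i rWW'; apply: IH => //.
    - by rewrite leq_subLR (leq_trans rW)// -addSnnS leq_add2r.
    - exact: thicken_open.
    - exact: thicken_convex.
    - exact: sub_thicken.
    - exact: thicken_invariant.
  exists ([set w' | `|w' - w| < e], [set N' | N < N']).
    split; first exact: near_norm.
    by apply: nbhs_pinfty_gt; rewrite num_real.
  move=> [w' N'] /= [w'w NN'] s l _ s0 _ _ li Al wl.
  have [c [z [cz cN wz]]] := Ne w' s l w'w s0 li Al wl.
  exists c, z; split=> //.
    by apply: comb_sub cz; apply: lattice_points_sub; exact: ltW.
  by apply: le_trans cN _; rewrite ler_wpM2r// ltW.
move=> [N0 [_ covN]].
pose N1 := Num.max N0 0 + 1.
have N01 : N0 < N1 by rewrite ltr_pwDr// le_max lexx.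
have N10 : 0 < N1 by rewrite ltr_pwDr// le_max lexx orbT.
have [N2 bdd] := generated_bounded Wi AW N1.
have [c c0 cW] := residue_bounded W.
pose N3 := Num.max N1 N2.
have N30 : 0 < N3 by rewrite lt_max N10.
pose N := Num.max N3 (N3 * c).
exists N => [|x l li Al xl]; first by rewrite le_max ltW.
suff [c' [z [cz cN xz]]] : exists c' z, [/\ comb (lattice_points A N3) c' z,
    c' <= N3 * `|residue W x| & (residue W x - z <= W)%MS].
  exists c', z; split.
  - by apply: comb_sub cz; apply: lattice_points_sub; rewrite le_max lexx.
  - apply: le_trans cN _; apply: (@le_trans _ _ (N3 * c * `|x|)).
      by rewrite -mulrA ler_wpM2l// ltW.
    by rewrite ler_wpM2r// le_max lexx orbT.
  - rewrite -[x](subrK (residue W x)) -addrA addmx_sub//.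
    exact: residue_sub.
have xl' : (residue W x - l <= W)%MS.
  rewrite -[residue W x](subKr x) addrAC addmx_sub// eqmx_opp.
  exact: residue_sub.
have xE : residue W (residue W x) = residue W x.
  apply/esym/residue_eq; exact: residue_sub.
move: (residue W x) xl' xE => y yl yE {x xl}.
have [yN|Ny] := leP `|y| N1.
  have [c' [z [cz cN yz]]] := bdd y l li Al yl yE yN.
  exists c', z; split=> //.
    by apply: comb_sub cz; apply: lattice_points_sub; rewrite le_max lexx orbT.
  by apply: le_trans cN _; rewrite ler_wpM2r// le_max lexx orbT.
have y0 : 0 < `|y| by apply: lt_trans Ny.
have yw : `|y| *: (`|y|^-1 *: y) = y.
  by rewrite scalerA mulfV ?gt_eqF// scale1r.
have := covN N1 N01 (`|y|^-1 *: y) _ `|y| l (ltW Ny) y0.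
rewrite yw; case=> //=.
- by rewrite normrZ normfV normr_id mulVf// gt_eqF.
- by rewrite /residue -scalemxAl -/(residue W y) yE.
- by rewrite normrZ normfV normr_id mulVf// gt_eqF.
move=> c' [z [cz cN yz]]; exists c', z; split=> //.
  by apply: comb_sub cz; apply: lattice_points_sub; rewrite le_max lexx.
by apply: le_trans cN _; rewrite ler_wpM2r// le_max lexx.
Qed.

End Generation.

(** * Fourier-Motzkin elimination *)

Section FourierMotzkin.
Context {R : realType} {n : nat}.

(** The existence of [t] amounts to the compatibility of each lower bound
    [a g / b g] (where [b g > 0]) with each upper bound [a h / b h] (where
    [b h < 0]), the constraint [0 <= t] being one more lower bound. *)
Lemma eliminate_variable (T : eqType) (gs : seq T) (a b : T -> R) :
  (exists2 t, 0 <= t & forall g, g \in gs -> a g <= t * b g) <->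
  (forall g, g \in gs -> b g <= 0 -> a g <= 0) /\
  (forall g h, g \in gs -> h \in gs -> 0 < b g -> b h < 0 ->
     a h * b g - a g * b h <= 0).
Proof.
split=> [[t t0 tP]|[neg mix]].
  split=> [g /tP ag bg|g h /tP ag /tP ah bg bh].
    by rewrite (le_trans ag)// mulr_ge0_le0.
  have : a h * b g <= t * b h * b g by rewrite ler_wpM2r// ltW.
  have : t * b g * b h <= a g * b h by rewrite ler_wnM2r// ltW.
  lra.
exists (\big[Num.max/0]_(g <- gs | 0 < b g) (a g / b g)).
  by rewrite bigmax_idl le_max lexx.
move=> g gg; have [bg|bg|bg] := ltgtP (b g) 0.
- rewrite -ler_ndivlMr//; rewrite big_seq_cond; apply: bigmax_le.
    by rewrite -[a g / _]mulrNN -invrN divr_ge0 ?oppr_ge0 ?neg// ltW.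
  move=> h /andP[hh bh]; rewrite ler_pdivrMr// mulrAC ler_ndivlMr//.
  by have := mix h g hh gg bh bg; lra.
- rewrite -ler_pdivrMr//.
  exact: (@Order.TotalTheory.bigmax_sup_seq _ _ _ _ _ g).
- by rewrite bg mulr0 neg// bg.
Qed.

Implicit Types (g h : 'cV[rat]_n * rat) (x : 'rV[R]_n) (c : R).

(** A rational linear form on R^n x R; the second variable is the total weight
    of a combination, and setting it to 1 gives an affine form. *)
Definition form_val g x c : R :=
  (x *m map_mx ratr g.1) 0 0 + c * ratr g.2.

Definition form_lin (p q : rat) g h : 'cV[rat]_n * rat :=
  (p *: g.1 + q *: h.1, p * g.2 + q * h.2).

Lemma form_lin_val p q g h x c :
  form_val (form_lin p q g h) x c =
  ratr p * form_val g x c + ratr q * form_val h x c.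
Proof.
rewrite /form_val /= map_mxD !map_mxZ mulmxDr -!scalemxAr.
move: (x *m _) (x *m _) => X Y.
by rewrite !mxE rmorphD !rmorphM /=; ring.
Qed.

Lemma form_val_sub g x c t (f : 'rV[rat]_n) :
  form_val g (x - t *: map_mx ratr f) (c - t) =
  form_val g x c - t * ratr ((f *m g.1) 0 0 + g.2).
Proof.
rewrite /form_val mulmxBl -scalemxAl -map_mxM rmorphD /=.
move: (x *m _) (f *m _) => X Y.
by rewrite !mxE; ring.
Qed.

Definition rat_points (s : seq 'rV[rat]_n) : set 'rV[R]_n :=
  [set x | exists2 f, f \in s & x = map_mx ratr f].

Lemma comb_points_nil x c : comb (rat_points [::]) c x <-> c = 0 /\ x = 0.
Proof.
split=> [|[-> ->]]; last exact: comb_nil.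
by elim=> // s f d y _ [].
Qed.

Lemma comb_points_cons f s x c : comb (rat_points (f :: s)) c x <->
  exists2 t, 0 <= t & comb (rat_points s) (c - t) (x - t *: map_mx ratr f).
Proof.
split=> [|[t t0 cx]].
  elim=> [|r _ d y r0 [f' + ->] _ [t t0 IH]].
    by exists 0; rewrite // scale0r !subr0; exact: comb_nil.
  rewrite inE => /predU1P[->|f's].
    exists (r + t); rewrite ?addr_ge0// scalerDl.
    by rewrite !opprD addrACA subrr add0r addrACA subrr add0r.
  exists t => //; rewrite -!addrA; apply: comb_cons => //.
  by exists f'.
rewrite -[x](subrK (t *: map_mx ratr f)) -[c](subrK t).
apply: comb_add.
  by apply: comb_sub cx => y [f' f's ->]; exists f'; rewrite // inE f's orbT.
by apply: comb_atom => //; exists f; rewrite ?mem_head.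
Qed.

(** Adding a generator [f] to [s] amounts to projecting along its coefficient,
    which preserves the rational polyhedral cones of R^n x R. *)
Lemma comb_points_forms s : exists gs : seq ('cV[rat]_n * rat), forall x c,
  comb (rat_points s) c x <-> forall g, g \in gs -> form_val g x c <= 0.
Proof.
elim: s => [|f s [gs gsP]].
  pose e j : 'cV[rat]_n * rat := (delta_mx j 0, 0).
  pose gs0 := [:: (0, 1); (0, -1)] ++ [seq e j | j <- enum 'I_n] ++
    [seq (- (e j).1, 0) | j <- enum 'I_n].
  exists gs0 => x c.
  have ex j : (x *m map_mx ratr (delta_mx j 0)) 0 0 = x 0 j.
    rewrite mxE (bigD1 j)//= big1 => [|i /negPf ij].
      by rewrite !mxE !eqxx rmorph1 mulr1 addr0.
    by rewrite !mxE ij rmorph0 mulr0.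
  rewrite comb_points_nil; split=> [[-> ->] g _|H].
    by rewrite /form_val mul0mx mxE mul0r addr0.
  have c1 : c <= 0.
    have := H (0, 1); rewrite /form_val map_mx0 mulmx0 mxE add0r rmorph1 mulr1.
    by apply; rewrite mem_head.
  have c2 : - c <= 0.
    have := H (0, -1).
    rewrite /form_val map_mx0 mulmx0 mxE add0r rmorphN1 mulrN1.
    by apply; rewrite !inE eqxx orbT.
  split; first by lra.
  apply/rowP => j; rewrite mxE; apply/eqP; rewrite eq_le; apply/andP; split.
    have ejs : e j \in gs0.
      by rewrite !mem_cat map_f ?mem_enum ?orbT.
    by have := H _ ejs; rewrite /form_val /= ex rmorph0 mulr0 addr0.
  have ejs : (- (e j).1, 0) \in gs0.
    by rewrite !mem_cat (map_f (fun j => (- (e j).1, 0))) ?mem_enum ?orbT.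
  have := H _ ejs.
  by rewrite /form_val /= map_mxN mulmxN mxE ex rmorph0 mulr0 addr0 oppr_le0.
pose b g := (f *m g.1) 0 0 + g.2.
exists ([seq g <- gs | b g <= 0] ++
  [seq form_lin (b g) (- b h) h g | g <- [seq g <- gs | 0 < b g],
     h <- [seq h <- gs | b h < 0]]) => x c.
rewrite comb_points_cons.
have -> : (exists2 t, 0 <= t &
      comb (rat_points s) (c - t) (x - t *: map_mx ratr f)) <->
    (exists2 t, 0 <= t &
      forall g, g \in gs -> form_val g x c <= t * ratr (b g)).
  split=> -[t t0 H]; exists t => //.
    by move=> g gg; have /gsP/(_ g gg) := H; rewrite form_val_sub subr_le0.
  by apply/gsP => g gg; rewrite form_val_sub subr_le0 H.
rewrite eliminate_variable; split=> [[neg mix] g|H].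
  rewrite mem_cat => /orP[|/allpairsP[[g1 g2] /=]].
    rewrite mem_filter => /andP[bg gg]; apply: neg => //.
    by rewrite -(rmorph0 (@ratr R)) ler_rat.
  rewrite !mem_filter => -[/andP[b1 g1g] /andP[b2 g2g] ->].
  rewrite form_lin_val rmorphN mulNr mulrC [ratr (b g2) * _]mulrC.
  by apply: mix; rewrite // -(rmorph0 (@ratr R)) ltr_rat.
split=> [g gg|g h gg hg].
  rewrite -(rmorph0 (@ratr R)) ler_rat rmorph0 => bg.
  by apply: H; rewrite mem_cat mem_filter bg gg.
rewrite -(rmorph0 (@ratr R)) !ltr_rat rmorph0 => bg bh.
have := H (form_lin (b g) (- b h) h g).
rewrite form_lin_val rmorphN mulNr mulrC [ratr (b h) * _]mulrC; apply.
rewrite mem_cat; apply/orP; right; apply/allpairsP; exists (g, h).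
by rewrite !mem_filter bg bh gg hg.
Qed.

End FourierMotzkin.

(** * Combinations in a nondegenerate cone *)

Section Cone.
Context {R : realType} {n : nat} (C : set 'rV[R]_n).
Implicit Types (v x a b f : 'rV[R]_n).
Hypotheses (C_open : open C) (C_convex : convex_set C).
Hypothesis C_scale : forall (t : R) v, 0 < t -> C v -> C (t *: v).

Lemma cone_add a b : C a -> C b -> C (a + b).
Proof.
move=> Ca Cb.
have half : 0 <= 1 / 2 :> R by rewrite divr_ge0.
have := C_scale (ltr0n R 2)
  (convex_set_comb C_convex half half (esym (splitr 1)) Ca Cb).
by rewrite scalerDr !scalerA mulrC divfK// !scale1r.
Qed.

(** A point of an open convex cone may be moved by an element of the closure:
    the error made in approximating [w] inside the cone is absorbed by a ball
    around [a]. *)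
Lemma cone_closure_add w a t : (forall r : R, 0 < r ->
    exists2 w', `|w' - w| < r & C w') -> 0 <= t -> C a -> C (a + t *: w).
Proof.
move=> cw; rewrite le_eqVlt => /predU1P[<-|t0] Ca.
  by rewrite scale0r addr0.
have [r r0 rC] := open_has_ball C_open Ca.
have [|w' w'w Cw'] := cw (r / t); first exact: divr_gt0.
have -> : a + t *: w = (a + t *: (w - w')) + t *: w'.
  by apply/rowP => j; rewrite !mxE; ring.
apply: cone_add; last exact: C_scale.
by apply: rC; rewrite normrZ gtr0_norm// distrC mulrC -ltr_pdivlMr.
Qed.

Hypothesis C_nondegenerate :
  ~ exists p v, v != 0 /\ forall t : R, C (p + t *: v).

(** Two points of [C] of norm about 1 cannot nearly cancel: by compactness [C]
    would have both [w] and [- w] in its closure for some unit vector [w], hence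
    contain a line parallel to [w]. *)
Lemma cone_sum_ge : exists2 N : R, 1 <= N & forall a b, C a -> C b ->
  `|a| <= N * `|a + b|.
Proof.
pose Q (N : R) w := forall b, C w -> C b -> 1 <= N * `|w + b|.
have : \forall N \near +oo%R, [set w : 'rV[R]_n | `|w| = 1] `<=` Q N.
  have /compact_near_coveringP := @unit_sphere_compact R n.
  apply => w /= w1.
  have [[r r0 rC]|cw] :=
    pselect (exists2 r, 0 < r & forall w', `|w' - w| < r -> ~ C w').
    exists ([set w' | `|w' - w| < r], setT).
      by split; [exact: near_norm|exact: filterT].
    by move=> [w' N] /= [/rC Cw _] b /Cw.
  have [[r r0 rC]|cnw] :=
    pselect (exists2 r, 0 < r & forall b, `|b - - w| < r -> ~ C b).
    have r2 : 0 < r / 2 by rewrite divr_gt0.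
    exists ([set w' | `|w' - w| < r / 2], [set N | (r / 2)^-1 < N]).
      split; first exact: near_norm.
      by apply: nbhs_pinfty_gt; rewrite num_real.
    move=> [w' N] /= [w'w rN] b Cw' Cb.
    have N0 : 0 < N by apply: lt_trans rN; rewrite invr_gt0.
    rewrite mulrC -ler_pdivrMr// mul1r -[N^-1]invrK.
    rewrite leNgt; apply/negP => w'b; apply: (rC b) => //.
    have -> : b - - w = (w' + b) - (w' - w).
      by apply/rowP => j; rewrite !mxE; ring.
    have Nr : N^-1 < r / 2 by rewrite invf_plt ?posrE.
    rewrite invrK in w'b.
    by rewrite (le_lt_trans (ler_normB _ _))//; lra.
  have cl u : ~ (exists2 r, 0 < r & forall w', `|w' - u| < r -> ~ C w') ->
      forall r : R, 0 < r -> exists2 w', `|w' - u| < r & C w'.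
    move=> H r r0; apply: contrapT => H'; apply: H; exists r => // w' w'u Cw'.
    by apply: H'; exists w'.
  move: cw cnw => /cl cw /cl cnw.
  exfalso.
  have [p _ Cp] := cw _ ltr01.
  apply: C_nondegenerate; exists p, w; split.
    by rewrite -normr_eq0 w1 oner_neq0.
  move=> t; have [t0|t0] := leP 0 t; first exact: cone_closure_add.
  rewrite -[t]opprK scaleNr -scalerN; apply: cone_closure_add => //.
  by rewrite oppr_ge0 ltW.
move=> [N0 [_ covN]]; pose N := Num.max N0 1 + 1.
have M1 : 1 <= Num.max N0 1 by rewrite le_max lexx orbT.
have N1 : 1 <= N by rewrite /N; lra.
exists N => // a b Ca Cb.
have [->|a0] := eqVneq a 0; first by rewrite normr0 mulr_ge0// (le_trans ler01).
have na : 0 < `|a| by rewrite normr_gt0.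
have : 1 <= N * `|(`|a|^-1 *: a) + (`|a|^-1 *: b)|.
  apply: (covN N).
  - by rewrite /N ltr_pwDr// le_max lexx.
  - by rewrite /= normrZ normfV normr_id mulVf// gt_eqF.
  - by apply: C_scale; rewrite ?invr_gt0.
  - by apply: C_scale; rewrite ?invr_gt0.
rewrite -scalerDr normrZ normfV normr_id mulrCA mulrC.
by rewrite -ler_pdivrMr ?invr_gt0// invrK mul1r.
Qed.

(** Terms of weight zero contribute nothing and are dropped; if all the others
    have a large generator, the second alternative holds. *)
Lemma comb_dichotomy (S : set 'rV[R]_n) r c x : comb S c x ->
  (exists v t y, [/\ S v, `|v| <= r, 0 < t, comb S (c - t) y & x = t *: v + y])
  \/ comb [set v | S v /\ r < `|v|] c x.
Proof.
elim=> [|s f d y s0 Sf dy IH]; first by right; exact: comb_nil.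
have [s_gt0|] := ltP 0 s; last first.
  move=> s_le0; have -> : s = 0 by apply/eqP; rewrite eq_le s_le0.
  by rewrite add0r scale0r add0r.
have [fr|rf] := leP `|f| r.
  by left; exists f, s, y; split=> //; rewrite addrAC subrr add0r.
case: IH => [[v [t [z [Sv vr t0 dz ->]]]]|IH].
  left; exists v, t, (s *: f + z); split=> //; last by rewrite addrCA.
  by rewrite -addrA; exact: comb_cons.
by right; exact: comb_cons.
Qed.

Let C0 : set 'rV[R]_n := [set x | x = 0 \/ C x].

Let C0_add a b : C0 a -> C0 b -> C0 (a + b).
Proof.
move=> [->|Ca] [->|Cb]; rewrite ?addr0 ?add0r; [by left|by right|by right|].
by right; exact: cone_add.
Qed.

Let C0_scale (t : R) a : 0 <= t -> C0 a -> C0 (t *: a).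
Proof.
rewrite le_eqVlt => /predU1P[<-|t0]; first by rewrite scale0r; left.
by move=> [->|Ca]; [rewrite scaler0; left|right; exact: C_scale].
Qed.

Lemma norm_le_sum x : `|x| <= \sum_j `|x 0 j|.
Proof.
apply: norm_le => [|i j]; first exact: sumr_ge0.
by rewrite ord1 (bigD1 j)//= lerDl sumr_ge0.
Qed.

(** Here [p j] is the partial sum over the generators with nonnegative [j]th
    coordinate: the [j]th coordinate of [p j] minus that of [x - p j] is the
    weighted sum of the absolute values of the [j]th coordinates of the
    generators. *)
Lemma comb_split_sign r c x : comb [set v | C v /\ r < `|v|] c x ->
  exists p : 'I_n -> 'rV[R]_n,
    (forall j, C0 (p j) /\ C0 (x - p j)) /\
    r * c <= \sum_j (p j 0 j - (x - p j) 0 j).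
Proof.
elim=> [|s f d y s0 [Cf rf] _ [p [pC rp]]].
  exists (fun=> 0); split=> [j|]; first by rewrite subr0; split; left.
  by rewrite mulr0 sumr_ge0// => j _; rewrite !mxE !subrr.
have sf : C0 (s *: f) by apply: C0_scale => //; right.
exists (fun j => if 0 <= f 0 j then s *: f + p j else p j); split=> [j|].
  have [pj ypj] := pC j; case: ifP => _.
    by rewrite opprD addrACA subrr add0r; split=> //; exact: C0_add.
  by rewrite -addrA; split=> //; exact: C0_add.
rewrite mulrDr.
apply: (@le_trans _ _ (\sum_j s * `|f 0 j| + \sum_j (p j 0 j - (y - p j) 0 j))).
  apply: lerD => //; rewrite -mulr_sumr mulrC ler_wpM2l//.
  by rewrite (le_trans (ltW rf))// norm_le_sum.
rewrite -big_split /=; apply: ler_sum => j _.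
case: (leP 0 (f 0 j)) => fj; rewrite !mxE.
  by rewrite ger0_norm//; lra.
by rewrite ltr0_norm//; lra.
Qed.

(** Otherwise all generators are large, the sum of the norms of the terms is
    large, and [comb_split_sign] makes one of [p j] and [x - p j] large.  Each
    of these lies in [C] or is 0, and their sum is [x], which contradicts
    [cone_sum_ge]. *)
Lemma small_generator : exists2 N : R, 0 <= N & forall (S : set 'rV[R]_n) x,
  S `<=` C -> comb S 1 x ->
  exists v t y, [/\ S v, `|v| <= N * `|x| + 1, 0 < t, comb S (1 - t) y
    & x = t *: v + y].
Proof.
have [N N1 NP] := cone_sum_ge.
have N0 : 0 <= N by apply: le_trans N1.
have C0_le a b : C0 a -> C0 b -> `|a| <= N * `|a + b|.
  move=> [->|Ca] Cb; first by rewrite normr0 mulr_ge0.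
  case: Cb => [->|Cb]; last exact: NP.
  by rewrite addr0 ler_peMl.
exists (n%:R * (N + N)); first by rewrite mulr_ge0// addr_ge0.
move=> S x SC /(@comb_dichotomy _ (n%:R * (N + N) * `|x| + 1))[//|].
move=> /(comb_sub _) cx.
have [|p [pC]] := @comb_split_sign (n%:R * (N + N) * `|x| + 1) 1 x.
  by apply: cx => v [/SC].
rewrite mulr1 => H; exfalso; move: H; apply/negP; rewrite -ltNge.
apply: (@le_lt_trans _ _ (\sum_(j < n) (N + N) * `|x|)); last first.
  by rewrite sumr_const card_ord -[ltLHS]mulr_natl mulrA ltrDl.
apply: ler_sum => j _; have [Cp Cxp] := pC j.
have := C0_le _ _ Cp Cxp; have := C0_le _ _ Cxp Cp.
rewrite subrK [p j + _]addrC subrK => H1 H2.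
rewrite mulrDl lerD//.
  by rewrite (le_trans _ H2)// (le_trans (ler_norm _))// entry_le_norm.
rewrite (le_trans _ H1)// (le_trans (ler_norm _))// normrN entry_le_norm//.
Qed.

End Cone.

(** * The hull of the lattice points of a cone, in coordinates *)

(** The last point, on the segment parametrized by [0, 1], of a polyhedron
    containing its origin: either the end of the segment or a point where some
    constraint becomes violated. *)
Lemma segment_exit (R : realType) (T : eqType) (gs : seq T) (a b : T -> R) :
  (forall g, g \in gs -> a g <= 0) ->
  exists s, [/\ 0 <= s <= 1, forall g, g \in gs -> a g + s * b g <= 0 &
    s = 1 \/ exists2 g, g \in gs & 0 < b g /\ a g + s * b g = 0].
Proof.
elim: gs => [|g gs IH] a0.
  by exists 1; split=> //; [rewrite ler01 lexx|left].
have [s [/andP[s0 s1] sP sE]] :=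
  IH (fun h hgs => a0 h (mem_behead (s := g :: gs) hgs)).
have ag := a0 g (mem_head _ _).
have [gs0|gs0] := leP (a g + s * b g) 0.
  exists s; split; first by rewrite s0.
    by move=> h; rewrite inE => /predU1P[->//|]; exact: sP.
  by case: sE => [|[h hgs hE]]; [left|right; exists h; rewrite // inE hgs orbT].
have bg : 0 < b g by nra.
exists (- a g / b g).
have r0 : 0 <= - a g / b g by rewrite divr_ge0 ?oppr_ge0// ltW.
have rs : - a g / b g <= s by rewrite ler_pdivrMr//; lra.
have rg : a g + - a g / b g * b g = 0 by rewrite divfK ?gt_eqF// subrr.
split; first by rewrite r0 (le_trans rs).
  move=> h; rewrite inE => /predU1P[->|hgs]; first by rewrite rg.
  have := sP h hgs; have := a0 h; rewrite inE hgs orbT => /(_ isT).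
  move: (- a g / b g) r0 rs => r r0 rs ah sh.
  have [bh|bh] := leP 0 (b h).
    by apply: le_trans sh; rewrite lerD2l ler_wpM2r.
  nra.
by right; exists g; rewrite ?mem_head.
Qed.

Section Hull.
Context {R : realType} {n : nat} (C : set 'rV[R]_n).
Implicit Types (v x f : 'rV[R]_n).

Lemma lattice_points_rational N :
  exists s : seq 'rV[rat]_n, lattice_points C N = rat_points s.
Proof.
have /finite_seqP[s sE] := finite_lattice_points C N.
exists [seq map_mx (fun a => (Num.floor a)%:~R) f | f <- s].
have fE f : intmx f -> f = map_mx ratr (map_mx (fun a => (Num.floor a)%:~R) f).
  by move=> /mxOverP fi; apply/rowP => j; rewrite !mxE ratr_int floorK.
rewrite sE; apply/seteqP; split=> [f fs|_ [_ /mapP[f fs ->] ->]].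
  have [fi _ _] : lattice_points C N f by rewrite sE.
  by exists (map_mx (fun a => (Num.floor a)%:~R) f); [exact: map_f|exact: fE].
have [fi _ _] : lattice_points C N f by rewrite sE.
by rewrite /= -fE.
Qed.

Lemma form_val_affine (g : 'cV[rat]_n * rat) x y (s c : R) :
  form_val g (x + s *: (y - x)) c =
  form_val g x c + s * (form_val g y c - form_val g x c).
Proof.
rewrite /form_val mulmxDl -scalemxAl mulmxBl.
by move: (x *m _) (y *m _) => X Y; rewrite !mxE; ring.
Qed.

Hypotheses (C_open : open C) (C_convex : convex_set C).
Hypothesis C_scale : forall (t : R) v, 0 < t -> C v -> C (t *: v).
Hypothesis C_nondegenerate :
  ~ exists p v, v != 0 /\ forall t : R, C (p + t *: v).

Let CL : set 'rV[R]_n := [set f | intmx f /\ C f].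

(** This is [int_cone_generated] for the translate of [C] by [- v], with [W]
    trivial. *)
Lemma local_cone v : intmx v -> C v -> exists N, forall x, comb CL 1 x ->
  exists c z, comb (lattice_points C N) c z /\ x - v = z - c *: v.
Proof.
move=> vi Cv.
pose A : set 'rV[R]_n := [set f | C (f + v)].
have A_open : open A.
  apply: has_ball_open => a /(open_has_ball C_open)[r r0 rC].
  by exists r => // u /rC; rewrite addrAC.
have A_convex : convex_set A.
  apply: comb_convex_set => a b s t s0 t0 st Aa Ab; rewrite /A /=.
  rewrite (_ : _ + v = s *: (a + v) + t *: (b + v)).
    exact: convex_set_comb.
  by rewrite -[v in LHS]scale1r -st scalerDl !scalerDr addrACA.
have [||m0 y /=|N N0 NP] :=
  int_cone_generated (W := (0 : 'M[R]_n)) A_open A_convex.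
- by rewrite /A /= add0r.
- exact: intmx0.
- by move=> Aa; rewrite submx0 => /eqP ->; rewrite addr0.
exists (N + `|v|) => x cx.
have [c cxv] : exists c, comb (lattice_points A N) c (x - 1 *: v).
  apply: comb_bind cx => l [li Cl].
  have [|||c [z [cz _ lz]]] := NP (l - v) (l - v).
  - exact: intmxB.
  - by rewrite /A /= subrK.
  - by rewrite subrr sub0mx.
  exists c; move: lz; rewrite submx0 subr_eq0 => /eqP ->.
  exact: cz.
rewrite scale1r in cxv.
exists c, (x - v + c *: v); split; last by rewrite addrK.
apply/comb_shift/comb_sub/cxv => f [fi Af fN]; split=> //.
  exact: intmxD.
by rewrite (le_trans (ler_normD _ _))// lerD2r.
Qed.

(** All small generators [v] are treated with one bound [N] since they are
    finitely many.  A point [y] where the segment from [v0] to [x] would leave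
    the hull of the points of norm at most [N] still has norm at most [M1],
    hence a generator [v] of norm at most [M2] with positive weight [t]. *)
Lemma hull_bounded M : exists N, forall x, comb CL 1 x -> `|x| <= M ->
  comb (lattice_points C N) 1 x.
Proof.
have [K K0 small] := small_generator C_open C_convex C_scale C_nondegenerate.
pose M1 := Num.max M (K * M + 1); pose M2 := K * M1 + 1.
have MM1 : M <= M1 by rewrite le_max lexx.
have KM1 : K * M + 1 <= M1 by rewrite /M1 le_max lexx orbT.
have KM2 : K * M + 1 <= M2 by rewrite lerD2r ler_wpM2l.
have [N0 N0P] : exists N, forall v, lattice_points C M2 v ->
    forall x, comb CL 1 x ->
    exists c z, comb (lattice_points C N) c z /\ x - v = z - c *: v.
  apply: (@finite_uniform R _ _ (fun v N => forall x, comb CL 1 x ->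
    exists c z, comb (lattice_points C N) c z /\ x - v = z - c *: v)).
  - exact: finite_lattice_points.
  - move=> v N N' NN H x /H[c [z [cz xv]]]; exists c, z; split=> //.
    by apply: comb_sub cz; exact: lattice_points_sub.
  - by move=> v [vi Cv _]; exact: local_cone.
pose N := Num.max N0 M2.
exists N => x cx xM.
have [gs gsP] : exists gs : seq ('cV[rat]_n * rat), forall y c,
    comb (lattice_points C N) c y <-> forall g, g \in gs -> form_val g y c <= 0.
  have [s ->] := lattice_points_rational N; exact: comb_points_forms.
have [|v0 [t0 [y0 [[v0i Cv0] v0x _ _ _]]]] := small CL x _ cx.
  by move=> f [].
have v0M : `|v0| <= K * M + 1.
  by rewrite (le_trans v0x)// lerD2r ler_wpM2l.
have v0N : lattice_points C N v0.
  by split=> //; rewrite (le_trans v0M)// (le_trans KM2)// le_max lexx orbT.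
have cv0 : comb (lattice_points C N) 1 v0.
  by rewrite -[v0]scale1r; exact: comb_atom.
have := segment_exit (fun g => form_val g x 1 - form_val g v0 1)
  (iffLR (gsP _ _) cv0).
move=> [s [/andP[s0 s1] sP sE]].
pose y := v0 + s *: (x - v0).
have cy : comb (lattice_points C N) 1 y.
  by apply/gsP => g /sP; rewrite form_val_affine.
case: sE => [sE|[g ggs [bg gE]]].
  by move: cy; rewrite /y sE scale1r addrC subrK.
have yM : `|y| <= M1.
  have -> : y = s *: x + (1 - s) *: v0.
    by apply/rowP => j; rewrite !mxE; ring.
  rewrite (le_trans (ler_normD _ _))// !normrZ !ger0_norm ?subr_ge0//.
  rewrite (_ : M1 = s * M1 + (1 - s) * M1); last by ring.
  apply: lerD; rewrite ler_wpM2l ?subr_ge0//; first exact: le_trans MM1.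
  exact: le_trans KM1.
have [|v [t [y' [[vi Cv vN] vy t_gt0 cy' yE]]]] := small _ y _ cy.
  by move=> f [].
have vM2 : lattice_points C M2 v.
  by split=> //; rewrite (le_trans vy)// lerD2r ler_wpM2l.
have [c [z [cz xv]]] := N0P v vM2 x cx.
have {}cz : comb (lattice_points C N) c z.
  by apply: comb_sub cz; apply: lattice_points_sub; rewrite le_max lexx.
have c0 := comb_ge0 cz.
have tc : 0 < t + c + 1 by lra.
(* [e] is small enough for the weight of [v] in [y + e *: (x - y)] to be
   nonnegative. *)
pose e := t / (t + c + 1).
have e0 : 0 < e by rewrite divr_gt0.
have ete : e * (t + c + 1) = t by rewrite divfK// gt_eqF.
have e1 : e <= 1 by rewrite ler_pdivrMr//; lra.
have ce : comb (lattice_points C N) 1 (y + e *: (x - y)).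
  have -> : y + e *: (x - y) =
      ((1 - e) * t + e - e * c) *: v + ((1 - e) *: y' + e *: z).
    have -> : x = v + (z - c *: v) by rewrite -xv addrC subrK.
    by rewrite yE; apply/rowP => j; rewrite !mxE; ring.
  rewrite [X in comb _ X _](_ : 1 =
    ((1 - e) * t + e - e * c) + ((1 - e) * (1 - t) + e * c)); last by ring.
  apply: comb_add; first by apply: comb_atom => //; lra.
  by apply: comb_add; apply: comb_scale => //; [rewrite subr_ge0|exact: ltW].
have := iffLR (gsP _ _) ce g ggs.
rewrite form_val_affine /y form_val_affine gE add0r.
set b := form_val g x 1 - _ in bg gE *.
have -> : e * (form_val g x 1 - 0) = e * ((1 - s) * b).
  by rewrite -gE /b; ring.
move: s1; rewrite le_eqVlt => /predU1P[sE _|s1].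
  by move: cy; rewrite /y sE scale1r addrC subrK.
by rewrite leNgt => /negP; case; rewrite mulr_gt0// mulr_gt0// subr_gt0.
Qed.

(** Near a point [x] outside the hull, the hull coincides with that of finitely
    many points, from which [x] is separated by one of its linear
    inequalities. *)
Lemma hull_closed : closed (comb CL 1).
Proof.
rewrite -openC; apply: has_ball_open => x nx.
have [N NP] := hull_bounded (`|x| + 1).
have [s sE] := lattice_points_rational N.
have [gs gsP] := @comb_points_forms R n s.
rewrite -sE in gsP.
have [g ggs gx] : exists2 g, g \in gs & 0 < form_val g x 1.
  apply: contrapT => H; apply: nx.
  have /comb_sub : lattice_points C N `<=` CL by move=> f [].
  apply; apply/gsP => g ggs; rewrite leNgt; apply/negP => gx.
  by apply: H; exists g.
have [c c0 cP] := mulmx_bounded (map_mx ratr g.1 : 'cV[R]_n).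
exists (Num.min 1 (form_val g x 1 / c)) => [|u].
  by rewrite lt_min ltr01 divr_gt0.
rewrite lt_min => /andP[u1 uc] cxu.
have xu : `|x + u| <= `|x| + 1.
  by rewrite (le_trans (ler_normD _ _))// lerD2l ltW.
have /gsP/(_ g ggs) := NP _ cxu xu.
apply/negP; rewrite -ltNge.
have -> : form_val g (x + u) 1 = form_val g x 1 + (u *m map_mx ratr g.1) 0 0.
  rewrite /form_val mulmxDl.
  by move: (x *m _) (u *m _) => X U; rewrite !mxE; ring.
have := le_trans (entry_le_norm (u *m map_mx ratr g.1) 0 0) (cP _ u).
rewrite ler_norml => /andP[+ _].
by rewrite ltr_pdivlMr// mulrC in uc; lra.
Qed.

End Hull.

(** * Passage to an abstract vector space *)

Lemma rational_polyhedronI (R : realType) (V : vectType R) (Q P P' : set V) :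
  rational_polyhedron Q P -> rational_polyhedron Q P' ->
  rational_polyhedron Q (P `&` P').
Proof.
move=> [m [f [fQ ->]]] [m' [f' [f'Q ->]]].
exists (m + m')%N, (fun i =>
  match fintype.split i with inl j => f j | inr j => f' j end).
split=> [i|]; first by case: (fintype.split i).
apply/seteqP; split=> [v [fv f'v] i|v fv]; first by case: (fintype.split i).
split=> i; first by have := fv (lshift m' i); rewrite (unsplitK (inl i)).
by have := fv (rshift m i); rewrite (unsplitK (inr i)).
Qed.

Lemma comb_image (R : realType) (V U : lmodType R) (h : {linear V -> U})
    (S : set V) (T : set U) c x :
  (forall f, S f -> T (h f)) -> comb S c x -> comb T c (h x).
Proof.
move=> ST; elim=> [|s f d y s0 Sf _ IH].
  by rewrite linear0; exact: comb_nil.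
by rewrite linearD linearZ; apply: comb_cons => //; exact: ST.
Qed.

Section Transport.
Context {R : realType} {V : vectType R}.
Let n := \dim {:V}.
Context (b : n.-tuple V) (b_basis : basis_of {:V} b).
Let phi : V -> 'rV[R]_n := rVof b.
Let psi : 'rV[R]_n -> V := vecof b.

Lemma change_of_basis (e e' : n.-tuple V) : basis_of {:V} e ->
  exists T : 'M[R]_n, forall v, rVof e' v = rVof e v *m T.
Proof.
move=> e_basis; exists (mxof e e' \1%VF) => v.
by rewrite -rVof_app// id_lfunE.
Qed.

Lemma lattice_int v : inIntSpan b v <-> intmx (phi v).
Proof.
have psiE x : psi x = \sum_i x 0 i *: b`_i by [].
split=> [[a ->]|/mxOverP vi].
  apply/mxOverP => i j; rewrite ord1.
  have -> : \sum_(i < n) b`_i *~ a i = psi (\row_i (a i)%:~R).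
    by rewrite psiE; apply: eq_bigr => k _; rewrite mxE scaler_int.
  by rewrite /phi /psi vecofK// mxE intr_int.
exists [ffun i => Num.floor (phi v 0 i)].
rewrite -[LHS](rVofK b_basis v : psi (phi v) = v) psiE; apply: eq_bigr => i _.
by rewrite ffunE -scaler_int floorK.
Qed.

Definition coordinate_form (a : 'cV[R]_n) (v : V) : R := (phi v *m a) 0 0.

Lemma coordinate_form_scalar a : scalar (coordinate_form a).
Proof.
move=> k u v; rewrite /coordinate_form /phi linearP mulmxDl -scalemxAl.
by move: (_ *m a) (_ *m a) => X Y; rewrite !mxE.
Qed.

HB.instance Definition _ a :=
  GRing.isLinear.Build R V R *%R (coordinate_form a) (coordinate_form_scalar a).

Lemma form_polyhedron (gs : seq ('cV[rat]_n * rat)) :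
  rational_polyhedron (rat_span [set v | inIntSpan b v])
    [set v | forall g, g \in gs -> form_val g (phi v) 1 <= 0].
Proof.
exists (size gs), (fun i v => form_val (nth (0, 0) gs i) (phi v) 1).
split=> [i|].
  set g := nth _ gs i; split.
    exists (coordinate_form (map_mx ratr g.1)), (ratr g.2) => v.
    by rewrite /form_val mul1r.
  move=> _ [v [m [q [l [lL ->]]]] <-].
  have [x xE] : exists x : 'rV[rat]_n,
      phi (\sum_(j < m) ratr (q j) *: l j) = map_mx ratr x.
    exists (\sum_j q j *: map_mx (fun r => (Num.floor r)%:~R) (phi (l j))).
    rewrite /phi linear_sum raddf_sum; apply: eq_bigr => j _.
    rewrite linearZ /= map_mxZ; congr (_ *: _).
    have /lattice_int/mxOverP li := lL j.
    move: li; rewrite /phi; move: (rVof b (l j)) => y li.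
    by apply/rowP => k; rewrite !mxE /= ratr_int floorK.
  exists ((x *m g.1) 0 0 + g.2) => //.
  rewrite xE /form_val -map_mxM mul1r rmorphD /=.
  by move: (x *m g.1) => y; rewrite mxE.
apply/seteqP; split=> [v gv i|v gv g /(nthP (0, 0))[i igs <-]].
  by apply: gv; exact: mem_nth.
exact: (gv (Ordinal igs)).
Qed.

Lemma mulmx_closed (T : 'M[R]_n) (D : set 'rV[R]_n) :
  closed D -> closed [set x | D (x *m T)].
Proof.
move=> cD; rewrite -openC; apply: has_ball_open => x Dx.
have [r r0 rD] : exists2 r, 0 < r & forall u, `|u| < r -> ~ D (x *m T + u).
  have [r r0 rD] := open_has_ball (closed_openC cD) Dx.
  by exists r => // u /rD.
have [c c0 cT] := mulmx_bounded T.
exists (r / c) => [|u]; first exact: divr_gt0.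
rewrite ltr_pdivlMr// mulrC /= mulmxDl => uc; apply: rD.
exact: le_lt_trans (cT _ u) uc.
Qed.

End Transport.

Theorem theorem2p2 (R : realType) (V : vectType R) (C L : set V)
    (C_open : vopen C) (C_convex : convex_set C) (C_cone : is_cone C)
    (C_nondegenerate : nondegenerate_set C) (L_lattice : is_lattice L) :
  locally_rationally_polyhedral (rat_span L) (convex_hull (C `&` L)) /\
  vclosed (convex_hull (C `&` L)).
Proof.
case: L_lattice => b b_basis ->{L}; set L := mkset _.
case: C_cone => _ C_scale.
pose n := \dim {:V}.
pose phi : V -> 'rV[R]_n := rVof b.
pose psi : 'rV[R]_n -> V := vecof b.
have phiK : cancel phi psi := rVofK b_basis.
have psiK : cancel psi phi := vecofK b_basis.
have [T TE] := change_of_basis b (vbasisP {:V}).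
have [T' T'E] := change_of_basis (vbasis {:V}) b_basis.
pose C' : set 'rV[R]_n := [set x | C (psi x)].
have C'_open : open C'.
  case: C_open => U oU UC.
  rewrite -[C']setCK openC (_ : ~` C' = [set x | (~` U) (x *m T')]).
    by apply: mulmx_closed; rewrite closedC.
  apply/seteqP; split=> x; rewrite /C' /= -UC /= /coords T'E -/phi psiK => H //.
have C'_convex : convex_set C'.
  move=> x y k; rewrite !inE /C' /= => Cx Cy.
  have := C_convex _ _ k (mem_set Cx) (mem_set Cy).
  by rewrite inE /conv /= /psi linearD !linearZ.
have C'_scale (t : R) x : 0 < t -> C' x -> C' (t *: x).
  by move=> t0 Cx; rewrite /C' /= /psi linearZ; exact: C_scale.
have C'_nondeg : ~ exists p v, v != 0 /\ forall t : R, C' (p + t *: v).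
  move=> [p [v [v0 pv]]]; apply: C_nondegenerate; exists (psi p), (psi v).
  split; first by rewrite vecof_eq0.
  by move=> t; have := pv t; rewrite /C' /= /psi linearD linearZ.
pose CL : set 'rV[R]_n := [set f | intmx f /\ C' f].
have hullE v : convex_hull (C `&` L) v <-> comb CL 1 (phi v).
  rewrite comb_hull; split=> [|cv].
    apply: comb_image => f [Cf Lf]; split; last by rewrite /C' /= phiK.
    exact/lattice_int.
  rewrite -[v]phiK; apply: comb_image cv => f [fi Cf]; split=> //.
  by apply/lattice_int => //; rewrite -/phi psiK.
split=> [P P_poly [M [_ MP]]|].
  have [c c0 cT] := mulmx_bounded T.
  have PM v : P v -> `|phi v| <= c * (M + 1).
    move=> Pv; rewrite /phi TE (le_trans (cT _ _))// ler_wpM2l//.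
      exact: ltW.
    have M1 : M < M + 1 by rewrite ltrDl.
    by have := MP _ M1 (coords v); apply; exists v.
  have [N NP] :=
    hull_bounded C'_open C'_convex C'_scale C'_nondeg (c * (M + 1)).
  have [s sE] := lattice_points_rational C' N.
  have [gs gsP] := @comb_points_forms R n s.
  rewrite -sE in gsP.
  have -> : convex_hull (C `&` L) `&` P =
      [set v | forall g, g \in gs -> form_val g (phi v) 1 <= 0] `&` P.
    apply/seteqP; split=> v [Kv Pv]; split=> //.
      by apply/gsP/NP; [exact/hullE|exact: PM].
    apply/hullE; move/gsP: Kv; apply: comb_sub => f []//.
  exact: rational_polyhedronI (form_polyhedron b_basis gs) P_poly.
have cl := mulmx_closed (T := T)
  (hull_closed C'_open C'_convex C'_scale C'_nondeg).
have -> : convex_hull (C `&` L) =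
    coords @^-1` [set x | comb CL 1 (x *m T)].
  by apply/seteqP; split=> v; rewrite /= -TE => /hullE.
have /continuous_closedP := @initial_continuous _ _ (@coords R V).
exact.
Qed.
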